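(* Let $\mathbf m=(m_1,\dots,m_n)$ be positive integers, $M=\sum_i m_i$, $M_i=\sum_{k=1}^i m_k$ ($M_0=0$), and let $\beta\in S_M$ be the permutation whose one-line notation lists $M_0+1,M_1+1,\dots,M_{n-1}+1$, then $M_{n-1}+2,\dots,M_n$ in increasing order, then $M_{n-2}+2,\dots,M_{n-1}$ in increasing order, and so on, ending with $2,\dots,M_1$. For $i\in[M]$ let $r_i(\beta)=\#\{j<i\mid \beta_j>\beta_i\}$, and let $\lambda$ be the partition (Ferrers diagram) whose parts are the positive values among $r_1(\beta),\dots,r_M(\beta)$ (with multiplicity), arranged in decreasing order. Then the number of maximal chains in $\mathbf{BL}(\mathbf m)$ is \[\frac{|\lambda|!}{\prod_{(i,j)\in\lambda}h_{i,j}},\] where $h_{i,j}$ is the hook length of the cell $(i,j)$ of $\lambda$, i.e. the number of cells $(k,l)\in\lambda$ with either $k=i,\ l\ge j$ or $l=j,\ k\ge i$.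
   Context: $\mathbf{BL}(\mathbf m)$ is the set of words of the multiset with $m_i$ copies of $i$ ($i\in[n]$) in which, for each $i\in[n-1]$, the first occurrence of $i$ precedes the first occurrence of $i+1$, partially ordered by the reflexive-transitive closure of: $s\lessdot t$ iff $t$ arises from $s$ by swapping two adjacent entries $a<b$ appearing as $ab$ in $s$. A maximal chain is a chain from the minimum to the maximum element in which each step is a cover. *)

(* Defs.v *)
From HB Require Import structures.
From mathcomp Require Import all_boot all_order all_algebra perm.

Set Implicit Arguments.
Unset Strict Implicit.
Unset Printing Implicit Defensive.

Import Order.TTheory GRing.Theory.

(* Indices and letters are 0-based throughout: the letter i of [n] is the      *)
(* ordinal of value i - 1, so m i below is the multiplicity m_{i+1}.           *)

Definition mtotal n (m : 'I_n -> nat) : nat := \sum_(i < n) m i.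

Definition psum n (m : 'I_n -> nat) (i : nat) : nat := \sum_(k < n | k < i) m k.

Definition is_BL n (m : 'I_n -> nat) (w : (mtotal m).-tuple 'I_n) : bool :=
  [forall i : 'I_n, count_mem i w == m i]
  && [forall i : 'I_n, forall j : 'I_n,
        (j == i.+1 :> nat) ==> (index i w < index j w)].

Record BL n (m : 'I_n -> nat) := MkBL {
  BLval :> (mtotal m).-tuple 'I_n;
  BLvalP : is_BL BLval }.

HB.instance Definition _ n (m : 'I_n -> nat) := [isSub for @BLval n m].
HB.instance Definition _ n (m : 'I_n -> nat) := [Finite of BL m by <:].

Section Order.
Variables (n : nat) (m : 'I_n -> nat).
Implicit Types s t : BL m.

Definition BL_step : rel (BL m) := fun s t =>
  [exists k : 'I_(mtotal m), exists l : 'I_(mtotal m),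
    [&& l == k.+1 :> nat, tnth s k < tnth s l &
        BLval t == [tuple tnth s (tperm k l i) | i < mtotal m]]].

Definition BL_le : rel (BL m) := connect BL_step.

Let weight s := \sum_(i < mtotal m) i * tnth s i.

Lemma BL_step_weight s t : BL_step s t -> weight t < weight s.
Proof.
case/existsP=> k /existsP[l /and3P[/eqP lk lt_kl /eqP tE]].
have neq_lk : l != k by rewrite -val_eqE /= lk gtn_eqF.
rewrite /weight (bigD1 k) //= (bigD1 l) //= [ltnRHS](bigD1 k) //=.
rewrite [in ltnRHS](bigD1 l) //= !addnA.
rewrite [X in _ + X < _](_ : _ =
    \sum_(i < mtotal m | (i != k) && (i != l)) i * tnth s i); last first.
  by apply: eq_bigr => i /andP[ik il]; rewrite tE tnth_mktuple tpermD 1?eq_sym.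
rewrite ltn_add2r tE !tnth_mktuple tpermL tpermR lk !mulSn.
by rewrite addnCA [ltnRHS]addnCA [X in _ < _ + X]addnC ltn_add2r.
Qed.

Lemma BL_le_weight s t : BL_le s t -> (s == t) || (weight t < weight s).
Proof.
case/connectP=> p; elim: p s => [|u p IHp] s /=.
  by move=> _ ->; rewrite eqxx.
case/andP=> /BL_step_weight lt_us u_p def_t; apply/orP; right.
by case/orP: (IHp _ u_p def_t) => [/eqP <- // | /ltn_trans-> //].
Qed.

Lemma BL_le_refl : reflexive BL_le.
Proof. exact: connect0. Qed.

Lemma BL_le_anti : antisymmetric BL_le.
Proof.
move=> s t /andP[/BL_le_weight/orP[/eqP //|lt_ts]].
case/BL_le_weight/orP=> [/eqP //|lt_st].
by have := ltn_trans lt_ts lt_st; rewrite ltnn.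
Qed.

Lemma BL_le_trans : transitive BL_le.
Proof. exact: connect_trans. Qed.

End Order.

Fact BL_display : Order.disp_t. Proof. exact: Order.Disp tt tt. Qed.

HB.instance Definition _ n (m : 'I_n -> nat) :=
  Order.Le_isPOrder.Build BL_display (BL m)
    (@BL_le_refl n m) (@BL_le_anti n m) (@BL_le_trans n m).

Section MaxChains.
Context {d : Order.disp_t} {T : finPOrderType d}.

Definition covers (x y : T) : bool :=
  (x < y)%O && [forall z : T, ~~ (x < z < y)%O].

Definition is_max_chain (c : seq T) : bool :=
  if c is x :: p then
    [&& [forall y : T, (x <= y)%O], [forall y : T, (y <= last x p)%O]
      & path covers x p]
  else false.

Lemma size_max_chain (c : seq T) : is_max_chain c -> size c <= #|T|.
Proof.
case: c => // x p /and3P[_ _ /(@sub_path _ _ <%O) c_p].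
have {c_p} : sorted <%O (x :: p) by apply: c_p => y z /andP[].
by move/lt_sorted_uniq/card_uniqP <-; apply: max_card.
Qed.

End MaxChains.

(* The length bound of the bounded sequences only makes the type finite; it    *)
(* excludes no chain, by size_max_chain.                                       *)
Definition max_chains {d : Order.disp_t} (T : finPOrderType d) :
    {set {bseq #|T| of T}} :=
  [set c : {bseq #|T| of T} | is_max_chain c].

(* With 0-based i, psum m i is M_i, and the i-th block is M_i + 2 .. M_{i+1}.  *)
Definition beta_word n (m : 'I_n -> nat) : seq nat :=
  [seq (psum m i).+1 | i : 'I_n <- enum 'I_n]
  ++ flatten [seq iota (psum m i).+2 (m i).-1 | i : 'I_n <- rev (enum 'I_n)].

Definition one_line N (s : 'S_N) : seq nat :=
  [seq (s i).+1 | i : 'I_N <- enum 'I_N].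

Definition r_val N (s : 'S_N) (i : 'I_N) : nat :=
  #|[set j : 'I_N | (j < i) && (s i < s j)]|.

Definition lam N (s : 'S_N) : seq nat :=
  sort geq [seq r <- [seq r_val s i | i : 'I_N <- enum 'I_N] | 0 < r].

(* A partition is the sequence of its parts; cells are 0-based (row, column).  *)
Definition cells (l : seq nat) : seq (nat * nat) :=
  [seq (i, j) | i <- iota 0 (size l), j <- iota 0 (nth 0 l i)].

Definition hook (l : seq nat) (c : nat * nat) : nat :=
  count (fun e => (e.1 == c.1) && (c.2 <= e.2) || (e.2 == c.2) && (c.1 <= e.1))
        (cells l).

Lemma psum_ord n (m : 'I_n -> nat) (i : 'I_n) : psum m i.+1 = psum m i + m i.
Proof.
rewrite /psum (bigD1 i) //= addnC; congr (_ + _).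
by apply: eq_bigl => k; rewrite ltnS leq_eqVlt -val_eqE; case: ltngtP.
Qed.

(* Positivity of m is needed here: m i = 0 would repeat an entry.              *)
Lemma beta_word_perm n (m : 'I_n -> nat) :
  (forall i, 0 < m i) -> perm_eq (beta_word m) (iota 1 (mtotal m)).
Proof.
move=> m_gt0.
have -> : iota 1 (mtotal m) =
    flatten [seq iota (psum m i).+1 (m i) | i : 'I_n <- enum 'I_n].
  have flat k : k <= n -> iota 1 (psum m k) =
      flatten [seq iota (psum m i).+1 (m i) | i : 'I_n <- take k (enum 'I_n)].
    elim: k => [|k IHk] lt_kn; first by rewrite take0 /psum big_pred0.
    pose i := Ordinal lt_kn; rewrite (psum_ord m i) iotaD add1n IHk 1?ltnW //.
    rewrite (take_nth i) ?size_enum_ord // map_rcons flatten_rcons.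
    by rewrite (nth_ord_enum i i).
  have := flat n (leqnn n); rewrite take_oversize ?size_enum_ord // => <-.
  by congr iota; apply: eq_bigl => k; rewrite ltn_ord.
apply/seq.permP => a; rewrite /beta_word count_cat !count_flatten.
rewrite !map_rev sumn_rev.
move: (enum _) => e; rewrite -!map_comp; elim: e => //= i s IHs.
case: (m i) (m_gt0 i) => //= k _.
by rewrite addnACA -IHs.
Qed.

Lemma beta_exists n (m : 'I_n -> nat) :
  (forall i, 0 < m i) -> exists s : 'S_(mtotal m), one_line s = beta_word m.
Proof.
move=> /beta_word_perm pm; set w := beta_word m.
have sz : size w = mtotal m by rewrite (perm_size pm) size_iota.
have bnd (i : 'I_(mtotal m)) : 0 < nth 0 w i <= mtotal m.
  have: nth 0 w i \in w by rewrite mem_nth ?sz.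
  by rewrite (perm_mem pm) mem_iota add1n ltnS.
have lt (i : 'I_(mtotal m)) : (nth 0 w i).-1 < mtotal m.
  by case/andP: (bnd i); case: (nth 0 w i).
have inj : injective (fun i : 'I_(mtotal m) => Ordinal (lt i)).
  move=> i j /(congr1 val)/= eq_ij; apply/val_inj/eqP.
  rewrite -(nth_uniq 0 (s := w)) ?sz ?(perm_uniq pm) ?iota_uniq //=.
  case/andP: (bnd i) (bnd j) => [gi _] /andP[gj _].
  by rewrite -(prednK gi) -(prednK gj) eq_ij.
exists (perm inj); apply: (@eq_from_nth _ 0).
  by rewrite size_map size_enum_ord sz.
move=> k; rewrite size_map size_enum_ord => ltk; pose i := Ordinal ltk.
rewrite (nth_map i) ?size_enum_ord // (nth_ord_enum i i) permE /=.
by case/andP: (bnd i) => /prednK.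
Qed.

(* Main.v *)
Require Import Defs.
From HB Require Import structures.
From mathcomp Require Import all_boot all_order all_algebra perm.
From mathcomp Require Import fingroup ring zify mpoly.

(* Standardization identifies BL(m) with the interval [1, beta] of the weak
   order on S_M. Let the Schubert polynomials S_w satisfy S_w = d_i S_{s_i w},
   hence d_i S_w = 0, at each ascent i of w, d_i being the divided difference; as
   beta has a weakly increasing left code r, S_beta is the monomial x^r. Let L be
   the linear form
     L (x^a) = det ((a_i + i) ^_ k) / prod_i (a_i + i)!,
   i.e. Frobenius' number of standard tableaux divided by |a|!, extended
   antisymmetrically. Then L (d_i f) is the i-th term of the recursion for these
   determinants, so sum_i L (d_i f) = deg f * L f, and l(w)! * L S_w satisfies the
   recursion that counts the saturated chains from 1 to w. At beta it equals
   l(beta)! * L (x^r), and L (x^r), a Vandermonde determinant over factorials, is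
   the inverse of the product of the hook lengths. *)

Set Implicit Arguments.
Unset Strict Implicit.
Unset Printing Implicit Defensive.

Import Order.TTheory GRing.Theory Num.Theory.

Local Open Scope ring_scope.

Lemma tperm_commute (T : finType) (i j k l : T) :
    i != k -> i != l -> j != k -> j != l ->
  (tperm i j * tperm k l = tperm k l * tperm i j)%g.
Proof.
by move=> ik il jk jl; apply/commgP/conjg_fixP; rewrite tpermJ !tpermD // eq_sym.
Qed.

Lemma tperm_braid (T : finType) (i j k : T) : i != j -> j != k -> i != k ->
  (tperm i j * (tperm j k * tperm i j) = tperm j k * (tperm i j * tperm j k))%g.
Proof.
move=> ij jk ik.
have E1 := tpermJ j k (tperm i j); have E2 := tpermJ i j (tperm j k).
rewrite /conjg !tpermV in E1 E2.
by rewrite E1 E2 tpermL tpermR (tpermD ik jk) tpermD // eq_sym.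
Qed.

Section DividedDifferenceRelations.
Variable R : idomainType.
Implicit Types (s t : {rmorphism R -> R}) (x y z u f g h : R).

Lemma quotient_commute s t x y z u f f1 f2 g1 g2 :
    x != y -> z != u -> s z = z -> s u = u -> t x = x -> t y = y ->
    s (t f) = t (s f) ->
    (y - x) * f1 = f - s f -> (u - z) * f2 = f1 - t f1 ->
    (u - z) * g1 = f - t f -> (y - x) * g2 = g1 - s g1 ->
  f2 = g2.
Proof.
move=> xy zu sz su tx ty C E1 E2 F1 F2.
have yx0 : y - x != 0 by rewrite subr_eq0 eq_sym.
have uz0 : u - z != 0 by rewrite subr_eq0 eq_sym.
apply: (mulfI yx0); apply: (mulfI uz0).
have tE1 : (y - x) * t f1 = t f - t (s f) by rewrite -rmorphB -E1 rmorphM rmorphB tx ty.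
have sF1 : (u - z) * s g1 = s f - s (t f) by rewrite -rmorphB -F1 rmorphM rmorphB sz su.
rewrite mulrCA E2 F2 !mulrBr E1 F1 tE1 sF1 C; ring.
Qed.

Lemma quotient_braid s t x y z f f1 f2 f3 g1 g2 g3 :
    x != y -> x != z -> y != z ->
    involutive s -> involutive t ->
    s x = y -> s y = x -> s z = z -> t x = x -> t y = z -> t z = y ->
    s (t (s f)) = t (s (t f)) ->
    (y - x) * f1 = f - s f -> (z - y) * f2 = f1 - t f1 -> (y - x) * f3 = f2 - s f2 ->
    (z - y) * g1 = f - t f -> (y - x) * g2 = g1 - s g1 -> (z - y) * g3 = g2 - t g2 ->
  f3 = g3.
Proof.
move=> xy xz yz sK tK sx sy sz tx ty tz C E1 E2 E3 F1 F2 F3.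
have yx0 : y - x != 0 by rewrite subr_eq0 eq_sym.
have zx0 : z - x != 0 by rewrite subr_eq0 eq_sym.
have zy0 : z - y != 0 by rewrite subr_eq0 eq_sym.
have tE1 : (z - x) * t f1 = t f - t (s f) by rewrite -rmorphB -E1 rmorphM rmorphB tx ty.
have sF1 : (z - x) * s g1 = s f - s (t f) by rewrite -rmorphB -F1 rmorphM rmorphB sz sy.
have E2' : (z - x) * (y - x) * (z - y) * f2 =
    (z - x) * (f - s f) - (y - x) * (t f - t (s f)).
  by rewrite -tE1 -E1 -mulrA E2; ring.
have F2' : (z - x) * (y - x) * (z - y) * g2 =
    (z - x) * (f - t f) - (z - y) * (s f - s (t f)).
  transitivity ((z - x) * (z - y) * ((y - x) * g2)); first by ring.
  by rewrite F2 -sF1 -F1; ring.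
have sE2' := congr1 s E2'; have tF2' := congr1 t F2'.
rewrite !(rmorphM, rmorphB) /= !(sx, sy, sz) sK in sE2'.
rewrite !(rmorphM, rmorphB) /= !(tx, ty, tz) tK in tF2'.
apply: (mulfI zx0); apply: (mulfI zy0); apply: (mulfI yx0).
transitivity (f - s f - t f + s (t f) + t (s f) - s (t (s f))).
  apply: (mulfI yx0).
  transitivity ((z - x) * (y - x) * (z - y) * f2
     + (z - y) * (x - y) * (z - x) * s f2).
    transitivity ((z - x) * (y - x) * (z - y) * ((y - x) * f3)); first by ring.
    by rewrite E3; ring.
  by rewrite E2' sE2'; ring.
symmetry; apply: (mulfI zy0).
transitivity ((z - x) * (y - x) * (z - y) * g2
   + (y - x) * (z - x) * (y - z) * t g2).
  transitivity ((z - x) * (y - x) * (z - y) * ((z - y) * g3)); first by ring.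
  by rewrite F3; ring.
by rewrite F2' tF2' C; ring.
Qed.

End DividedDifferenceRelations.

Section DividedDifferences.
Variable n : nat.
Implicit Types (i j k l : 'I_n) (f g h : {mpoly rat[n]}) (a : 'X_{1..n}).

Definition adjacent i j : bool := j == i.+1 :> nat.

Lemma adjacent_neq i j : adjacent i j -> i != j.
Proof. by move=> /eqP ij; rewrite -val_eqE /= ij neq_ltn ltnSn. Qed.

(* The sign is opposite to the usual one because codes below increase with the *)
(* position: d_i x_{i+1} = 1.                                                  *)
Definition divdiff i j f g : Prop := ('X_j - 'X_i) * g = f - msym (tperm i j) f.

Lemma msym_tpermK i j f : msym (tperm i j) (msym (tperm i j) f) = f.
Proof. by rewrite -msymMm tperm2 msym1m. Qed.

Lemma msym_tpermX i j k : msym (tperm i j) 'X_k = 'X_(tperm i j k) :> {mpoly rat[n]}.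
Proof.
rewrite msymX tpermV; congr mpolyX; apply/mnmP => l.
by rewrite mnmE !mnm1E -(inj_eq (@perm_inj _ (tperm i j))) tpermK.
Qed.

Lemma subX_neq0 i j : i != j -> 'X_j - 'X_i != 0 :> {mpoly rat[n]}.
Proof.
move=> neq_ij; rewrite subr_eq0; apply/eqP => /(congr1 (mcoeff U_(j)%MM)).
by rewrite !mcoeffX eqxx eq_mnm1 (negPf neq_ij) => /eqP; rewrite oner_eq0.
Qed.

Lemma divdiff_uniq i j f g h :
  i != j -> divdiff i j f g -> divdiff i j f h -> g = h.
Proof. by move=> /subX_neq0/mulfI inj; rewrite /divdiff => <- /inj. Qed.

Lemma divdiff_sym i j f g : i != j -> divdiff i j f g -> msym (tperm i j) g = g.
Proof.
move=> neq_ij E; apply: (mulfI (subX_neq0 neq_ij)).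
have := congr1 (msym (tperm i j)) E.
rewrite msymM !msymB !msym_tpermX msym_tpermK tpermL tpermR E => E'.
by rewrite -[RHS]opprB -E' -mulNr opprB.
Qed.

Lemma divdiff_comm i j k l f f1 f2 g1 g2 :
    uniq [:: i; j; k; l] ->
    divdiff i j f f1 -> divdiff k l f1 f2 ->
    divdiff k l f g1 -> divdiff i j g1 g2 ->
  f2 = g2.
Proof.
rewrite /= !inE !negb_or -!andbA => /and5P[ij ik il jk /and3P[jl kl _]].
apply: (@quotient_commute _ (msym (tperm i j)) (msym (tperm k l))).
- by rewrite -subr_eq0 -oppr_eq0 opprB subX_neq0.
- by rewrite -subr_eq0 -oppr_eq0 opprB subX_neq0.
- by rewrite /= msym_tpermX tpermD.
- by rewrite /= msym_tpermX tpermD.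
- by rewrite /= msym_tpermX tpermD // eq_sym.
- by rewrite /= msym_tpermX tpermD // eq_sym.
- by rewrite /= -!msymMm (tperm_commute ik il jk jl).
Qed.

Lemma divdiff_braid i j k f f1 f2 f3 g1 g2 g3 :
    uniq [:: i; j; k] ->
    divdiff i j f f1 -> divdiff j k f1 f2 -> divdiff i j f2 f3 ->
    divdiff j k f g1 -> divdiff i j g1 g2 -> divdiff j k g2 g3 ->
  f3 = g3.
Proof.
rewrite /= !inE negb_or -andbA => /and4P[ij ik jk _].
apply: (@quotient_braid _ (msym (tperm i j)) (msym (tperm j k))).
- by rewrite -subr_eq0 -oppr_eq0 opprB subX_neq0.
- by rewrite -subr_eq0 -oppr_eq0 opprB subX_neq0.
- by rewrite -subr_eq0 -oppr_eq0 opprB subX_neq0.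
- exact: msym_tpermK.
- exact: msym_tpermK.
- by rewrite /= msym_tpermX tpermL.
- by rewrite /= msym_tpermX tpermR.
- by rewrite /= msym_tpermX tpermD.
- by rewrite /= msym_tpermX tpermD // eq_sym.
- by rewrite /= msym_tpermX tpermL.
- by rewrite /= msym_tpermX tpermR.
- by rewrite /= -!msymMm tperm_braid.
Qed.

End DividedDifferences.

Section Boxed.
Variable n : nat.
Implicit Types (i j k l : 'I_n) (f g h : {mpoly rat[n]}) (a : 'X_{1..n}).

(* The box a_i <= i is stable under divided differences. It keeps x_0 out of   *)
(* all Schubert polynomials, without which sum_staircase_decr would fail.      *)
Definition in_box d a : bool := (mdeg a == d) && [forall i, a i <= i]%N.

Definition boxed d f : bool := all (in_box d) (msupp f).

Lemma in_boxP d a : reflect (mdeg a = d /\ forall i, (a i <= i)%N) (in_box d a).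
Proof. by apply: (iffP andP) => -[/eqP dega /forallP]. Qed.

Lemma boxed0 d : boxed d 0.
Proof. by rewrite /boxed msupp0. Qed.

Lemma boxedX d a : in_box d a -> boxed d 'X_[a].
Proof. by rewrite /boxed msuppX /= andbT. Qed.

Lemma boxedD d f g : boxed d f -> boxed d g -> boxed d (f + g).
Proof.
move=> /allP bf /allP bg; apply/allP => a /msuppD_le.
by rewrite mem_cat => /orP[/bf | /bg].
Qed.

Lemma boxedZ d c f : boxed d f -> boxed d (c *: f).
Proof. by move=> /allP bf; apply/allP => a /msuppZ_le /bf. Qed.

Lemma boxed_sum d (I : eqType) (s : seq I) (F : I -> {mpoly rat[n]}) :
  (forall x, x \in s -> boxed d (F x)) -> boxed d (\sum_(x <- s) F x).
Proof.
move=> bF; rewrite big_seq; elim/big_rec: _ => [|x f /bF]; first exact: boxed0.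
exact: boxedD.
Qed.

Lemma mdeg_pair i j a : i != j ->
  mdeg a = (a i + a j + \sum_(k | (k != i) && (k != j)) a k)%N.
Proof.
by move=> ij; rewrite mdegE (bigD1 i) //= (bigD1 j) 1?eq_sym //= addnA.
Qed.

Lemma divdiffX_exists d i j a : adjacent i j -> in_box d a ->
  exists2 g, boxed d.-1 g & divdiff i j 'X_[a] g.
Proof.
move=> adj_ij /in_boxP[dega box_a]; have neq_ij := adjacent_neq adj_ij.
move/eqP: adj_ij => def_j; have neq_ji : j != i by rewrite eq_sym.
pose r := minn (a i) (a j).
pose e : 'X_{1..n} := [multinom if (k == i) || (k == j) then r else a k | k < n].
have eE k : e k = if (k == i) || (k == j) then r else a k by rewrite mnmE.
pose D := (maxn (a i) (a j) - r)%N.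
pose g : {mpoly rat[n]} := 'X_[e] * \sum_(k < D) 'X_j ^+ (D.-1 - k) * 'X_i ^+ k.
have defD : (D = maxn (a i) (a j) - minn (a i) (a j))%N by [].
have box_g : boxed d.-1 g.
  rewrite /g mulr_sumr; apply: boxed_sum => k _; rewrite !mpolyXn -!mpolyXD.
  have lt_kD := ltn_ord k; apply/boxedX/in_boxP; split=> [|l].
    rewrite !mdegD !mdegMn !mdeg1 -dega !(mdeg_pair _ neq_ij) !eE !eqxx orbT /=.
    rewrite (eq_bigr a) => [|l /andP[/negPf li /negPf lj]]; last first.
      by rewrite eE li lj.
    by rewrite /r; lia.
  rewrite !mnmDE !mulmnE !mnm1E eE; move: (box_a i) (box_a j) (box_a l).
  have [-> | neq_li] := eqVneq l i.
    by rewrite ?eqxx ?(negPf neq_ji) ?eqxx /r /=; lia.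
  have [-> | neq_lj] := eqVneq l j.
    by rewrite ?eqxx ?(negPf neq_ij) ?eqxx ?orbT /r /=; lia.
  by rewrite /=; lia.
have sym_e : msym (tperm i j) 'X_[e] = 'X_[e] :> {mpoly rat[n]}.
  rewrite msymX tpermV; congr mpolyX; apply/mnmP => k; rewrite mnmE !eE.
  by case: tpermP => [->|->|]; rewrite ?eqxx ?orbT.
have dd_g : ('X_j - 'X_i) * g = 'X_[e] * ('X_j ^+ D - 'X_i ^+ D).
  rewrite /g mulrCA; congr (_ * _).
  case: (D) => [|D']; first by rewrite big_ord0 mulr0 subrr.
  by rewrite subrXX; congr (_ * _); apply: eq_bigr => k _; rewrite subnS.
have sX x y : msym (tperm i j) ('X_[e] * 'X_x ^+ y) = 'X_[e] * 'X_(tperm i j x) ^+ y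
    :> {mpoly rat[n]}.
  by rewrite msymM sym_e rmorphXn /= msym_tpermX.
have [le_ij | lt_ji] := leqP (a i) (a j).
  exists g => //; rewrite /divdiff dd_g.
  have -> : 'X_[a] = 'X_[e] * 'X_j ^+ D :> {mpoly rat[n]}.
    rewrite mpolyXn -mpolyXD; congr mpolyX; apply/mnmP => l.
    rewrite mnmDE mulmnE mnm1E eE.
    have [-> | neq_li] := eqVneq l i; first by rewrite ?eqxx ?(negPf neq_ji) /r /=; lia.
    have [-> | neq_lj] := eqVneq l j; first by rewrite ?eqxx ?orbT /r /=; lia.
    by rewrite /=; lia.
  by rewrite sX tpermR mulrBr.
exists (- g); first by rewrite -scaleN1r boxedZ.
rewrite /divdiff mulrN dd_g.
have -> : 'X_[a] = 'X_[e] * 'X_i ^+ D :> {mpoly rat[n]}.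
  rewrite mpolyXn -mpolyXD; congr mpolyX; apply/mnmP => l.
  rewrite mnmDE mulmnE mnm1E eE.
  have [-> | neq_li] := eqVneq l i; first by rewrite ?eqxx ?orbT /r /=; lia.
  have [-> | neq_lj] := eqVneq l j; first by rewrite ?eqxx ?(negPf neq_ij) ?orbT /r /=; lia.
  by rewrite /=; lia.
by rewrite sX tpermL mulrBr opprB.
Qed.

Lemma divdiff_exists d i j f : adjacent i j -> boxed d f ->
  exists2 g, boxed d.-1 g & divdiff i j f g.
Proof.
move=> adj_ij; suff gen s : all (in_box d) s -> exists2 g, boxed d.-1 g &
    divdiff i j (\sum_(a <- s) f@_a *: 'X_[a]) g by move/gen; rewrite -mpolyE.
elim: s => [_|a s IHs /= /andP[box_a /IHs[g box_g dd_g]]].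
  exists 0; first exact: boxed0.
  by rewrite /divdiff big_nil msym0 subrr mulr0.
have [h box_h dd_h] := divdiffX_exists adj_ij box_a.
exists (f@_a *: h + g); first by rewrite boxedD // boxedZ.
rewrite /divdiff big_cons msymD msymZ mulrDr dd_g -scalerAr dd_h scalerBr.
by rewrite opprD addrACA.
Qed.

End Boxed.

Section Code.
Variable N : nat.
Implicit Types (i j k l : 'I_N) (w : 'S_N).

Definition ascent w i j : bool := adjacent i j && (w i < w j)%N.

Definition inversions w : nat := \sum_(i < N) r_val w i.

Definition code w : 'X_{1..N} := [multinom r_val w i | i < N].

Lemma r_val_tperm w i j k :
  r_val (tperm i j * w)%g k =
    #|[set l | (tperm i j l < k)%N && (w (tperm i j k) < w l)%N]|.
Proof.
rewrite /r_val -[RHS](card_preimset _ (@perm_inj _ (tperm i j))).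
by apply: eq_card => l; rewrite !inE !permM tpermK.
Qed.

Lemma r_val_ascentl w i j : ascent w i j -> r_val (tperm i j * w)%g i = r_val w j.
Proof.
case/andP=> /eqP def_j lt_w; rewrite r_val_tperm; apply: eq_card => l.
rewrite !inE tpermL def_j ltnS.
case: tpermP => [->|->|/eqP li /eqP lj].
- by rewrite def_j ltnNge leqnSn leqnn /= ltnNge ltnW.
- by rewrite ltnn def_j ltnNge leqnn !andbF.
by rewrite [in RHS]leq_eqVlt val_eqE (negPf li).
Qed.

Lemma r_val_ascentr w i j :
  ascent w i j -> r_val (tperm i j * w)%g j = (r_val w i).+1.
Proof.
case/andP=> /eqP def_j lt_w; rewrite r_val_tperm.
rewrite (_ : [set l | _] = j |: [set l : 'I_N | (l < i)%N && (w i < w l)%N]).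
  by rewrite cardsU1 !inE def_j ltnNge leqnSn.
apply/setP => l; rewrite !inE tpermR def_j ltnS.
case: tpermP => [->|->|/eqP li /eqP lj].
- by rewrite def_j ltnn ltnNge leqnn -val_eqE /= def_j ltn_eqF.
- by rewrite leqnn lt_w eqxx.
by rewrite (negPf lj) leq_eqVlt val_eqE (negPf li).
Qed.

Lemma r_val_ascentD w i j k : adjacent i j -> k != i -> k != j ->
  r_val (tperm i j * w)%g k = r_val w k.
Proof.
move=> /eqP def_j ki kj; rewrite r_val_tperm; apply: eq_card => l.
rewrite !inE (@tpermD _ i j k) ?[_ == k]eq_sym //.
congr (_ && _).
move: ki kj; rewrite -!val_eqE /= def_j.
by case: tpermP => [->|->|_ _] //; rewrite def_j; lia.
Qed.

Lemma inversions_ascent w i j :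
  ascent w i j -> inversions (tperm i j * w)%g = (inversions w).+1.
Proof.
move=> asc_w; have /andP[adj_ij _] := asc_w; have neq_ij := adjacent_neq adj_ij.
rewrite /inversions (bigD1 i) // (bigD1 j) 1?eq_sym //=.
rewrite [in RHS](bigD1 i) // [in RHS](bigD1 j) 1?eq_sym //=.
rewrite r_val_ascentl // r_val_ascentr //.
rewrite (eq_bigr (r_val w)) => [|k /andP[ki kj]]; first by rewrite addSn addnS addnCA.
exact: r_val_ascentD.
Qed.

Lemma r_val_le w i : (r_val w i <= i)%N.
Proof.
rewrite -[leqRHS](size_iota 0) /r_val cardE -(size_map val).
apply: uniq_leq_size => [|_ /mapP[j + ->]].
  by rewrite map_inj_uniq ?enum_uniq //; apply: val_inj.
by rewrite mem_enum inE mem_iota add0n => /andP[].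
Qed.

Lemma inversions_le w : (inversions w <= N * N)%N.
Proof.
rewrite -[X in (_ <= X * _)%N](card_ord N) -sum_nat_const; apply: leq_sum => i _.
by rewrite (leq_trans (r_val_le w i)) // ltnW.
Qed.

Lemma in_box_code w : in_box (inversions w) (code w).
Proof.
apply/in_boxP; split=> [|i]; last by rewrite mnmE r_val_le.
by rewrite mdegE; apply: eq_bigr => i _; rewrite mnmE.
Qed.

Lemma inversions_gt_ind (P : 'S_N -> Prop) :
    (forall w, (forall w', (inversions w < inversions w')%N -> P w') -> P w) ->
  forall w, P w.
Proof.
move=> IH w; have [k] := ubnP (N * N - inversions w); elim: k w => // k IHk w.
rewrite ltnS => le_k; apply: IH => w' lt_ww'.
by apply: IHk; have := inversions_le w'; lia.
Qed.

End Code.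

Section Schubert.
Variable N : nat.
Implicit Types (i j k l : 'I_N) (w : 'S_N) (f g h : {mpoly rat[N]}).

(* A relation rather than a function: the choice of ascents is confluent, by   *)
(* the commutation and braid relations (schubert_uniq).                        *)
Inductive schubert w : {mpoly rat[N]} -> Prop :=
| schubert_top : (forall i j, ~~ ascent w i j) -> schubert w 'X_[code w]
| schubert_step i j f g : ascent w i j -> schubert (tperm i j * w)%g f ->
    divdiff i j f g -> schubert w g.

Lemma schubert_boxed w f : schubert w f -> boxed (inversions w) f.
Proof.
elim=> {w f} [w _|w i j f g asc_w _ box_f dd_g]; first exact/boxedX/in_box_code.
have /andP[adj_ij _] := asc_w.
have [h box_h /(divdiff_uniq (adjacent_neq adj_ij) dd_g) ->] :=
  divdiff_exists adj_ij box_f.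
by rewrite inversions_ascent in box_h.
Qed.

Lemma schubert_descend w i j f : ascent w i j -> schubert (tperm i j * w)%g f ->
  exists2 g, schubert w g & divdiff i j f g.
Proof.
move=> asc_w sch_f; have /andP[adj_ij _] := asc_w.
have [g _ dd_g] := divdiff_exists adj_ij (schubert_boxed sch_f).
by exists g => //; apply: schubert_step asc_w sch_f dd_g.
Qed.

Lemma schubert_exists w : exists f, schubert w f.
Proof.
elim/inversions_gt_ind: w => w IHw.
have [/existsP[i /existsP[j asc_w]] | /existsPn noasc] :=
  boolP [exists i, exists j, ascent w i j].
  have [|f /(schubert_descend asc_w)[g]] := IHw (tperm i j * w)%g; last by exists g.
  by rewrite inversions_ascent.
exists 'X_[code w]; apply: schubert_top => i j.
by have /existsPn := noasc i; apply.
Qed.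

Lemma schubert_uniq w f g : schubert w f -> schubert w g -> f = g.
Proof.
elim/inversions_gt_ind: w f g => w IHw.
have IHa i j f g : ascent w i j -> schubert (tperm i j * w)%g f ->
    schubert (tperm i j * w)%g g -> f = g.
  by move=> asc_w; apply: IHw; rewrite inversions_ascent.
have hexagon i j l f g f1 g1 : ascent w i j -> ascent w j l ->
    schubert (tperm i j * w)%g f1 -> divdiff i j f1 f ->
    schubert (tperm j l * w)%g g1 -> divdiff j l g1 g -> f = g.
  move=> asc_ij asc_jl sch_f1 dd_f sch_g1 dd_g.
  have /andP[adj_ij lt_ij] := asc_ij; have /andP[adj_jl lt_jl] := asc_jl.
  have ij := adjacent_neq adj_ij; have jl := adjacent_neq adj_jl.
  have il : i != l by rewrite -val_eqE /= (eqP adj_jl) (eqP adj_ij); lia.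
  have lt_il := ltn_trans lt_ij lt_jl.
  have ti : tperm j l i = i by rewrite tpermD // eq_sym.
  have tl : tperm i j l = l by rewrite tpermD // eq_sym.
  have asc_w' : ascent (tperm i j * w)%g j l.
    by rewrite /ascent adj_jl !permM tpermR tl.
  have asc_w'' : ascent (tperm j l * (tperm i j * w))%g i j.
    by rewrite /ascent adj_ij !permM ti tpermL tpermL tl.
  have asc_v' : ascent (tperm j l * w)%g i j.
    by rewrite /ascent adj_ij !permM ti tpermL.
  have asc_v'' : ascent (tperm i j * (tperm j l * w))%g j l.
    by rewrite /ascent adj_jl !permM tl tpermR ti tpermR.
  have [h sch_h] := schubert_exists (tperm i j * (tperm j l * (tperm i j * w)))%g.
  have [f3 sch_f3 dd_f3] := schubert_descend asc_w'' sch_h.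
  have [f2 sch_f2 dd_f2] := schubert_descend asc_w' sch_f3.
  have sch_h' : schubert (tperm j l * (tperm i j * (tperm j l * w)))%g h.
    by move: sch_h; rewrite !(mulgA _ _ w) tperm_braid.
  have [g3 sch_g3 dd_g3] := schubert_descend asc_v'' sch_h'.
  have [g2 sch_g2 dd_g2] := schubert_descend asc_v' sch_g3.
  rewrite (IHa _ _ _ _ asc_ij sch_f1 sch_f2) in dd_f.
  rewrite (IHa _ _ _ _ asc_jl sch_g1 sch_g2) in dd_g.
  apply: divdiff_braid dd_f3 dd_f2 dd_f dd_g3 dd_g2 dd_g.
  by rewrite /= !inE negb_or ij il jl.
move=> f g; case=> [noasc|i j f1 {}f asc_f sch_f1 dd_f].
  by case=> // i j f1 {}g asc_w; have := noasc i j; rewrite asc_w.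
case=> [noasc|k l g1 {}g asc_g sch_g1 dd_g].
  by have := noasc i j; rewrite asc_f.
have /andP[/eqP def_j lt_ij] := asc_f; have /andP[/eqP def_l lt_kl] := asc_g.
have [eq_ik | neq_ik] := eqVneq i k.
  have eq_jl : j = l by apply: val_inj; rewrite /= def_j def_l eq_ik.
  rewrite -eq_ik -eq_jl in sch_g1 dd_g.
  rewrite (IHa _ _ _ _ asc_f sch_f1 sch_g1) in dd_f.
  by apply: divdiff_uniq dd_f dd_g; apply: adjacent_neq; rewrite /adjacent def_j.
have [eq_jk | neq_jk] := eqVneq j k.
  by rewrite -eq_jk in asc_g sch_g1 dd_g; apply: hexagon sch_f1 dd_f sch_g1 dd_g.
have [eq_il | neq_il] := eqVneq i l.
  rewrite -eq_il in asc_g sch_g1 dd_g.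
  by apply/esym; apply: hexagon sch_g1 dd_g sch_f1 dd_f.
have neq_jl : j != l by rewrite -val_eqE /= def_j def_l eqSS val_eqE.
have asc_f' : ascent (tperm i j * w)%g k l.
  by rewrite /ascent /adjacent def_l eqxx !permM !tpermD.
have asc_g' : ascent (tperm k l * w)%g i j.
  by rewrite /ascent /adjacent def_j eqxx !permM !tpermD // eq_sym.
have [h sch_h] := schubert_exists (tperm k l * (tperm i j * w))%g.
have [f2 sch_f2 dd_f2] := schubert_descend asc_f' sch_h.
have sch_h' : schubert (tperm i j * (tperm k l * w))%g h.
  by rewrite mulgA tperm_commute // -mulgA.
have [g2 sch_g2 dd_g2] := schubert_descend asc_g' sch_h'.
rewrite (IHa _ _ _ _ asc_f sch_f1 sch_f2) in dd_f.
rewrite (IHa _ _ _ _ asc_g sch_g1 sch_g2) in dd_g.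
apply: divdiff_comm dd_f2 dd_f dd_g2 dd_g.
rewrite /= !inE !negb_or !(eq_sym k) !(eq_sym l) neq_ik neq_il neq_jk neq_jl /=.
by rewrite -!val_eqE /= def_l def_j !ltn_eqF.
Qed.

End Schubert.

Section Dominant.
Variable N : nat.
Implicit Types (i j k l : 'I_N) (w : 'S_N).

Lemma ascent_tperm w i j :
  adjacent i j -> (w j < w i)%N -> ascent (tperm i j * w)%g i j.
Proof. by move=> adj_ij lt_w; rewrite /ascent adj_ij !permM tpermL tpermR. Qed.

Lemma r_val_ascent_le w i j : ascent w i j -> (r_val w j <= r_val w i)%N.
Proof.
case/andP=> /eqP def_j lt_w; apply/subset_leq_card/subsetP => k; rewrite !inE.
rewrite def_j ltnS leq_eqVlt val_eqE => /andP[/predU1P[-> | ->] lt_wj].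
  by rewrite ltnNge ltnW in lt_wj.
exact: ltn_trans lt_wj.
Qed.

Lemma r_val_descent_lt w i j :
  adjacent i j -> (w j < w i)%N -> (r_val w i < r_val w j)%N.
Proof.
move=> adj_ij /(ascent_tperm adj_ij) asc_w; have := r_val_ascent_le asc_w.
rewrite -ltnS -(r_val_ascentl asc_w) -(r_val_ascentr asc_w).
by rewrite mulgA tperm2 mul1g.
Qed.

(* Swapping at the last place where the code stalls gives a permutation with   *)
(* weakly increasing code one step higher in the weak order.                   *)
Lemma schubert_dominant w :
    (forall i j, adjacent i j -> r_val w i <= r_val w j)%N ->
  schubert w 'X_[code w].
Proof.
elim/inversions_gt_ind: w => w IHw r_incr.
pose flat i := [exists j, adjacent i j && (r_val w i == r_val w j)].
have [i0 flat_i0 | noflat] := pickP flat; last first.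
  apply: schubert_top => i j; apply/negP => asc_w.
  have /existsP[] := noflat i; exists j; have /andP[adj_ij _] := asc_w.
  by rewrite adj_ij eqn_leq r_incr //= r_val_ascent_le.
case: (@arg_maxnP _ i0 flat (fun i => i : nat) flat_i0) => i /existsP[j].
case/andP=> adj_ij /eqP r_ij max_i; have neq_ij := adjacent_neq adj_ij.
have asc_w : ascent w i j.
  rewrite /ascent adj_ij ltnNge leq_eqVlt val_eqE (inj_eq perm_inj).
  rewrite eq_sym (negPf neq_ij); apply/negP => /(r_val_descent_lt adj_ij).
  by rewrite r_ij ltnn.
have [ri rj] := (r_val_ascentl asc_w, r_val_ascentr asc_w).
have rD k := @r_val_ascentD _ w i j k adj_ij.
apply: (schubert_step asc_w).
  apply: IHw => [|k l adj_kl]; first by rewrite inversions_ascent.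
  have [eq_kj | neq_kj] := eqVneq k j.
    rewrite {}eq_kj {k} in adj_kl *; have neq_lj : l != j by rewrite eq_sym adjacent_neq.
    have neq_li : l != i.
      by rewrite -val_eqE /= (eqP adj_kl) (eqP adj_ij); lia.
    rewrite rj (rD l) // r_ij ltn_neqAle r_incr // andbT.
    apply/negP => eq_r; have := max_i j; rewrite /= (eqP adj_ij) ltnn.
    by move=> H; suff: false by []; apply: H; apply/existsP; exists l; rewrite adj_kl.
  have [eq_lj | neq_lj] := eqVneq l j.
    have -> : k = i; last by rewrite eq_lj ri rj r_ij.
    by apply: val_inj; apply: succn_inj; rewrite -(eqP adj_kl) eq_lj (eqP adj_ij).
  have [eq_ki | neq_ki] := eqVneq k i.
    by case/eqP: neq_lj; apply: val_inj; rewrite /= (eqP adj_kl) eq_ki (eqP adj_ij).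
  rewrite (rD k) //; have [eq_li | neq_li] := eqVneq l i; last by rewrite rD // r_incr.
  by rewrite eq_li ri -r_ij r_incr // -eq_li.
have codeE : code (tperm i j * w)%g = (code w + U_(j))%MM.
  apply/mnmP => k; rewrite mnmDE mnm1E !mnmE.
  have [->|neq_kj] := eqVneq k j; first by rewrite rj r_ij addn1.
  have [->|neq_ki] := eqVneq k i; last by rewrite rD // addn0.
  by rewrite ri r_ij addn0.
have sym_code : msym (tperm i j) 'X_[code w] = 'X_[code w] :> {mpoly rat[N]}.
  rewrite msymX tpermV; congr mpolyX; apply/mnmP => k; rewrite !mnmE.
  by case: tpermP => [->|->|].
rewrite /divdiff codeE mpolyXD msymM sym_code msym_tpermX tpermR.
by rewrite mulrBl ![_ * 'X_[code w]]mulrC.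
Qed.

End Dominant.

Section AlternatingFunctional.
Variable N : nat.
Implicit Types (i j k l : 'I_N) (w : 'S_N) (f g h : {mpoly rat[N]}) (a b : 'X_{1..N}).

Definition alternant a : rat := \det (\matrix_(i < N, k < N) ((a i) ^_ k)%:R).

Definition weight a : rat := alternant a / \prod_(i < N) ((a i)`!)%:R.

Definition functional f : rat := \sum_(a <- msupp f) f@_a * weight a.

Lemma functional_widen f s : uniq s -> {subset msupp f <= s} ->
  functional f = \sum_(a <- s) f@_a * weight a.
Proof.
move=> uniq_s sub_s; rewrite (bigID (mem (msupp f))) /= [X in _ + X]big1 => [|a].
  rewrite addr0 -big_filter; apply: perm_big; apply: uniq_perm.
  - exact: msupp_uniq.
  - exact: filter_uniq.
  by move=> a; rewrite mem_filter; case: (boolP (a \in _)) => // /sub_s.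
by move=> /memN_msupp_eq0 ->; rewrite mul0r.
Qed.

Lemma functionalB f g : functional (f - g) = functional f - functional g.
Proof.
set s := undup (msupp f ++ msupp g); have uniq_s : uniq s := undup_uniq _.
rewrite !(@functional_widen _ s) => // [|a|a|a /msuppB_le].
- by rewrite -sumrB; apply: eq_bigr => a _; rewrite mcoeffB mulrBl.
- by rewrite mem_undup mem_cat orbC => ->.
- by rewrite mem_undup mem_cat => ->.
- by rewrite mem_undup.
Qed.

Lemma functional_mulX b f :
  functional ('X_[b] * f) = \sum_(a <- msupp f) f@_a * weight (b + a).
Proof.
rewrite (@functional_widen _ [seq (b + a)%MM | a <- msupp f]).
- by rewrite big_map; apply: eq_bigr => a _; rewrite (mulrC 'X_[b]) mcoeffMX.
- by rewrite map_inj_uniq ?msupp_uniq //; apply: addmI.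
by move=> a; rewrite (mulrC 'X_[b]) (perm_mem (msuppMX _ _)).
Qed.

Lemma weight_tperm i j a : i != j ->
  weight [multinom a (tperm i j k) | k < N] = - weight a.
Proof.
move=> neq_ij; rewrite /weight -mulNr; congr (_ / _).
  have -> : alternant [multinom a (tperm i j k) | k < N] =
      \det (row_perm (tperm i j) (\matrix_(k, l) ((a k) ^_ l)%:R)).
    by congr (\det _); apply/matrixP => k l; rewrite !mxE mnmE.
  by rewrite row_permE det_mulmx det_perm odd_tperm neq_ij expr1 mulN1r.
rewrite [RHS](reindex_inj (@perm_inj _ (tperm i j))) /=.
by apply: eq_bigr => k _; rewrite mnmE.
Qed.

Lemma functional_msym i j f : i != j ->
  functional (msym (tperm i j) f) = - functional f.
Proof.
move=> neq_ij.
pose t a := [multinom a (tperm i j k) | k < N].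
have tK : involutive t by move=> a; apply/mnmP => k; rewrite !mnmE tpermK.
rewrite (@functional_widen _ [seq t a | a <- msupp f]).
- rewrite big_map -sumrN; apply: eq_bigr => a _; rewrite mcoeff_sym.
  by rewrite -/(t (t a)) tK weight_tperm // mulrN.
- by rewrite map_inj_uniq ?msupp_uniq //; apply: (can_inj tK).
move=> a; rewrite mcoeff_msupp mcoeff_sym -mcoeff_msupp => /(map_f t).
by rewrite -/(t a) tK.
Qed.

(* Each Leibniz term for s, with the row j lowered, is a_j - s j times the     *)
(* original one.                                                               *)
Lemma alternant_decr a :
  \sum_j (a j)%:R * alternant (a - U_(j))%MM =
  ((mdeg a)%:R - (\sum_(j < N) j)%:R) * alternant a.
Proof.
rewrite {2}/alternant /determinant mulr_sumr.
under eq_bigr => j _ do rewrite /alternant /determinant mulr_sumr.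
rewrite exchange_big /=; apply: eq_bigr => s _.
under eq_bigr => j _ do rewrite mulrCA.
rewrite -mulr_sumr mulrCA; congr (_ * _).
have -> : (\sum_(j < N) j = \sum_(j < N) s j)%N.
  by rewrite (reindex_inj (@perm_inj _ s)).
rewrite mdegE !natr_sum -sumrB mulr_suml; apply: eq_bigr => j _.
rewrite [in RHS](bigD1 j) // [in LHS](bigD1 j) //= !mulrA; congr (_ * _).
  rewrite !mxE mnmBE mnm1E eqxx subn1 -natrM -ffactnS ffactnSr natrM mulrC.
  have [le_sa | lt_as] := leqP (s j) (a j); first by rewrite natrB.
  by rewrite ffact_small // !mulr0.
by apply: eq_bigr => i ij; rewrite !mxE mnmBE mnm1E eq_sym (negPf ij) subn0.
Qed.

Definition staircase : 'X_{1..N} := [multinom (i : nat) | i < N].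

Lemma sum_staircase_decr d f : boxed d f ->
  \sum_j \sum_(i | adjacent i j) functional ('X_[staircase - U_(j)] * f) =
  d%:R * functional ('X_[staircase] * f).
Proof.
move=> /allP box_f.
have -> : \sum_j \sum_(i | adjacent i j) functional ('X_[staircase - U_(j)] * f) =
    \sum_(a <- msupp f) f@_a *
      \sum_j \sum_(i | adjacent i j) weight (staircase - U_(j) + a)%MM.
  under eq_bigr => j _ do (under eq_bigr => i _ do rewrite functional_mulX).
  under eq_bigr => j _ do rewrite exchange_big.
  rewrite exchange_big; apply: eq_bigr => a _; rewrite mulr_sumr.
  by apply: eq_bigr => j _; rewrite mulr_sumr.
rewrite functional_mulX mulr_sumr; apply: eq_big_seq => a /box_f/in_boxP[dega box_a].
rewrite mulrCA; congr (_ * _); set A := (staircase + a)%MM.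
have AE k : A k = (k + a k)%N by rewrite mnmDE mnmE.
transitivity ((\sum_j (A j)%:R * alternant (A - U_(j))%MM) / \prod_k ((A k)`!)%:R).
  rewrite mulr_suml; apply: eq_bigr => j _.
  case def_j: (j : nat) => [|j'].
    have -> : A j = 0%N by apply/eqP; rewrite -leqn0 AE def_j -[X in (_ <= X)%N]def_j box_a.
    by rewrite !mul0r big_pred0 // => i; rewrite /adjacent def_j.
  have lt_j' : (j' < N)%N by rewrite -ltnS -def_j ltnS ltnW.
  rewrite (big_pred1 (Ordinal lt_j')) => [|i]; last first.
    by rewrite /adjacent def_j eqSS eq_sym /= -val_eqE.
  have -> : (staircase - U_(j) + a)%MM = (A - U_(j))%MM.
    apply/mnmP => k; rewrite mnmDE !mnmBE AE mnm1E mnmE.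
    by case: eqP => [<-|_]; lia.
  rewrite /weight (bigD1 j) //= [in RHS](bigD1 j) //=.
  have AjE : A j = (A j).-1.+1 by rewrite AE def_j.
  rewrite {1}(_ : \prod_(k | k != j) _ = \prod_(k | k != j) ((A k)`!)%:R); last first.
    apply: eq_bigr => k kj; rewrite mnmBE mnm1E eq_sym (negPf kj) subn0 //.
  rewrite mnmBE mnm1E eqxx subn1 [in RHS]AjE factS natrM /=.
  have: \prod_(k | k != j) ((A k)`!)%:R != 0 :> rat.
    by apply/prodf_neq0 => k _; rewrite pnatr_eq0 -lt0n fact_gt0.
  have: ((A j).-1`!)%:R != 0 :> rat by rewrite pnatr_eq0 -lt0n fact_gt0.
  have: ((A j).-1.+1)%:R != 0 :> rat by rewrite pnatr_eq0.
  have cancel (x y z u : rat) : x != 0 -> y != 0 -> z != 0 ->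
      u / (y * z) = x * u / (x * y * z).
    by move=> x0 y0 z0; field; rewrite z0 y0.
  exact: cancel.
rewrite alternant_decr -mulrA; congr (_ * _).
rewrite mdegD dega mdegE (eq_bigr (fun k : 'I_N => k : nat)) => [|k _]; last by rewrite mnmE.
by rewrite natrD addrAC subrr add0r.
Qed.

(* x^(staircase - e_j) is invariant under the transposition t = (i j), and     *)
(* [functional] changes sign under t. With g = d_i f this gives                *)
(*   2 functional (x^(staircase - e_j) f)                                      *)
(*     = functional (x^(staircase - e_j) (x_j - x_i) g)                       *)
(*     = 2 functional (x^staircase g).                                        *)
Lemma schubert_functional w f (F : 'I_N -> 'I_N -> {mpoly rat[N]}) :
    schubert w f ->
    (forall i j, adjacent i j -> (w j < w i)%N ->
       schubert (tperm i j * w)%g (F i j)) ->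
  (inversions w)%:R * functional ('X_[staircase] * f) =
  \sum_j \sum_(i | adjacent i j && (w j < w i)%N)
     functional ('X_[staircase] * F i j).
Proof.
move=> sch_f sch_F; rewrite -(sum_staircase_decr (schubert_boxed sch_f)).
apply: eq_bigr => j _; rewrite big_mkcondr; apply: eq_bigr => i adj_ij.
have neq_ij := adjacent_neq adj_ij; set y := 'X_[staircase - U_(j)].
have sym_y : msym (tperm i j) y = y.
  rewrite msymX tpermV; congr mpolyX; apply/mnmP => k.
  rewrite !(mnmE, mnmBE, mnm1E); case: tpermP => [->|->|//].
    by rewrite eqxx (eq_sym j) (negPf neq_ij) (eqP adj_ij) subn1 subn0.
  by rewrite eqxx (eq_sym j) (negPf neq_ij) (eqP adj_ij) subn1 subn0.
have fun_sym g : functional (y * msym (tperm i j) g) = - functional (y * g).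
  by rewrite -(functional_msym _ neq_ij) msymM sym_y.
have half (u v : rat) : u + u = v + v -> u = v.
  by rewrite -!mulr2n -[u *+ 2]mulr_natr -[v *+ 2]mulr_natr => /mulIf; apply; rewrite pnatr_eq0.
case: ifP => [lt_w | ge_w].
  have asc_w := ascent_tperm adj_ij lt_w.
  have tw : (tperm i j * (tperm i j * w))%g = w by rewrite mulgA tperm2 mul1g.
  have [|g sch_g dd_g] := schubert_descend asc_w (f := f); first by rewrite tw.
  rewrite (schubert_uniq (sch_F _ _ adj_ij lt_w) sch_g); apply: half.
  rewrite -{2}[functional (y * f)]opprK -fun_sym -functionalB -mulrBr -dd_g.
  rewrite mulrBl mulrBr functionalB; congr (_ + _); first rewrite mulrA -mpolyXD.
    congr (functional (mpolyX _ _ * _)); apply/mnmP => k.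
    rewrite !(mnmE, mnmDE, mnmBE, mnm1E); move: (eqP adj_ij).
    by case: (eqVneq j k) => [<-|_]; lia.
  rewrite -fun_sym msymM msym_tpermX tpermL (divdiff_sym neq_ij dd_g).
  rewrite mulrA -mpolyXD.
  congr (functional (mpolyX _ _ * _)); apply/mnmP => k.
  rewrite !(mnmE, mnmDE, mnmBE, mnm1E); move: (eqP adj_ij).
  by case: (eqVneq j k) => [<-|_]; lia.
have [g sch_g] := schubert_exists (tperm i j * w)%g.
have asc_w : ascent w i j.
  by rewrite /ascent adj_ij ltn_neqAle leqNgt ge_w val_eqE (inj_eq perm_inj) neq_ij.
have [h sch_h /(divdiff_sym neq_ij) sym_h] := schubert_descend asc_w sch_g.
rewrite (schubert_uniq sch_f sch_h); apply: half; rewrite addr0.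
by rewrite -{2}sym_h fun_sym subrr.
Qed.

End AlternatingFunctional.

Local Close Scope ring_scope.

Section Hooks.
Implicit Types (l s t b : seq nat).

Fixpoint shifted l : seq nat := if l is x :: t then x + size t :: shifted t else [::].

Fixpoint vandermonde b : nat :=
  if b is y :: b' then \prod_(z <- b') (y - z) * vandermonde b' else 1.

Definition hooks l : nat := \prod_(c <- cells l) hook l c.

Lemma size_shifted l : size (shifted l) = size l.
Proof. by elim: l => //= x l ->. Qed.

Lemma nth_shifted l i : i < size l -> nth 0 (shifted l) i = nth 0 l i + (size l - i.+1).
Proof. by elim: l i => // x l IHl [|i] lt_i; rewrite ?subn1 //= IHl. Qed.

Lemma shifted_succ l : shifted (map S l) = map S (shifted l).
Proof. by elim: l => //= x l ->; rewrite size_map addSn. Qed.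

Lemma shifted_rcons0 l : shifted (rcons l 0) = rcons (map S (shifted l)) 0.
Proof. by elim: l => //= x l ->; rewrite size_rcons addnS. Qed.

Lemma vandermonde_succ b : vandermonde (map S b) = vandermonde b.
Proof.
by elim: b => //= y b ->; rewrite big_map.
Qed.

Lemma vandermonde_rcons b x :
  vandermonde (rcons b x) = \prod_(y <- b) (y - x) * vandermonde b.
Proof.
elim: b => [|y b IHb] /=; first by rewrite !big_nil.
by rewrite IHb big_cons big_rcons /= (mulnC _ (y - x)) mulnACA.
Qed.

Lemma cells_nseq0 l k : cells (l ++ nseq k 0) = cells l.
Proof.
rewrite /cells size_cat iotaD map_cat flatten_cat size_nseq.
rewrite [X in _ ++ X](_ : _ = [::]) ?cats0.
  congr flatten; apply/eq_in_map => i; rewrite mem_iota => /andP[_ lt_i].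
  by rewrite nth_cat lt_i.
apply/nilP; rewrite /nilp size_flatten /shape -map_comp sumnE big_map big_seq.
rewrite big1 // => i; rewrite mem_iota => /andP[le_i _] /=.
by rewrite size_map size_iota nth_cat ltnNge le_i nth_nseq if_same.
Qed.

Lemma cells_succ l : perm_eq (cells (map S l))
  ([seq (i, 0) | i <- iota 0 (size l)] ++ [seq (c.1, c.2.+1) | c <- cells l]).
Proof.
rewrite /cells size_map; apply/seq.permP => p.
have: {subset iota 0 (size l) <= gtn (size l)} by move=> i; rewrite mem_iota.
elim: (iota 0 _) => //= i s IHs sub_s.
rewrite count_cat IHs => [|j js]; last by apply: sub_s; rewrite inE js orbT.
rewrite map_cat !count_cat (nth_map 0) /=; last by apply: sub_s; rewrite inE eqxx.
by rewrite (iotaDl 1 0) -!map_comp -addnA; congr (_ + _); rewrite addnCA.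
Qed.

Lemma count_row l i : i < size l -> count (fun c => c.1 == i) (cells l) = nth 0 l i.
Proof.
move=> lt_i; rewrite /cells count_flatten -map_comp sumnE big_map.
have -> : iota 0 (size l) = index_iota 0 (size l) by rewrite /index_iota subn0.
rewrite big_mkord (bigD1 (Ordinal lt_i)) //=.
rewrite count_map big1 => [|k]; last first.
  rewrite -val_eqE /= => /negPf ki; rewrite count_map.
  by rewrite (@eq_count _ _ pred0) ?count_pred0 // => j /=.
rewrite (@eq_count _ _ predT) => [|j]; last by rewrite /= eqxx.
by rewrite count_predT size_iota addn0.
Qed.

Lemma hook_succ l i j : hook (map S l) (i, j.+1) = hook l (i, j).
Proof.
rewrite /hook (seq.permP (cells_succ l)) count_cat !count_map.
rewrite (@eq_count _ _ pred0) ?count_pred0 => [|k]; last by rewrite /= andbF.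
by apply: eq_count => c; rewrite /= ltnS eqSS.
Qed.

Lemma hook_col0 l i : i < size l -> hook (map S l) (i, 0) = (nth 0 (shifted l) i).+1.
Proof.
move=> lt_i; rewrite /hook (seq.permP (cells_succ l)) count_cat !count_map.
rewrite nth_shifted // -addnS -subSn // subSS [RHS]addnC -(count_row lt_i).
congr (_ + _); last by apply: eq_count => c; rewrite /= andbT orbF.
rewrite (@eq_count _ _ (leq i)) => [|k]; last first.
  by rewrite /= andbT; case: eqP => [->|] //; rewrite leqnn.
rewrite -(subnKC (ltnW lt_i)) iotaD count_cat add0n addKn.
rewrite (@eq_in_count _ _ pred0 (iota 0 i)) ?count_pred0 => [|k]; last first.
  by rewrite mem_iota /= add0n ltnNge => /negPf.
rewrite (@eq_in_count _ _ predT (iota i _)) ?count_predT ?size_iota // => k.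
by rewrite mem_iota => /andP[].
Qed.

Lemma hooks_succ l : hooks (map S l) = \prod_(y <- shifted l) y.+1 * hooks l.
Proof.
rewrite /hooks (perm_big _ (cells_succ l)) big_cat !big_map /=; congr (_ * _).
  rewrite [RHS](big_nth 0) size_shifted /index_iota subn0.
  rewrite big_seq [RHS]big_seq; apply: eq_bigr => i; rewrite mem_iota.
  exact: hook_col0.
by apply: eq_bigr => -[i j] _; rewrite hook_succ.
Qed.

(* Removing the first column of a diagram divides out one hook per row and     *)
(* lowers every shifted part by one.                                           *)
Lemma hook_product l : sorted geq l ->
  vandermonde (shifted l) * hooks l = \prod_(y <- shifted l) y`!.
Proof.
have [k] := ubnP (sumn l + size l); elim: k l => // k IHk l.
case/lastP: l => [_ _|t x]; first by rewrite /hooks /cells !big_nil.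
rewrite sumn_rcons size_rcons => lt_k sorted_l; case: x => [|x] in lt_k sorted_l *.
  have sorted_t : sorted geq t.
    by apply: subseq_sorted sorted_l; [exact: (rev_trans leq_trans) | exact: subseq_rcons].
  rewrite shifted_rcons0 vandermonde_rcons vandermonde_succ.
  have -> : hooks (rcons t 0) = hooks t.
    by rewrite /hooks /hook -cats1 (cells_nseq0 t 1).
  rewrite big_rcons /= fact0 ?mul1n ?muln1 !big_map -mulnA IHk //; last by lia.
  by rewrite -big_split; apply: eq_bigr => y _; rewrite subn0 factS.
have [t' def_l] : exists t', rcons t x.+1 = map S t'.
  exists (map predn (rcons t x.+1)); rewrite -map_comp -[LHS]map_id.
  apply/eq_in_map => y; rewrite mem_rcons inE => /predU1P[-> //|].
  move: sorted_l; rewrite -(revK (rcons _ _)) rev_sorted rev_rcons /=.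
  rewrite path_sortedE; last exact: leq_trans.
  by rewrite all_rev => /andP[/allP le_x _] /le_x /= ; case: y.
rewrite def_l in sorted_l *; rewrite shifted_succ vandermonde_succ hooks_succ big_map.
rewrite mulnCA IHk.
- by rewrite -big_split; apply: eq_bigr => y _; rewrite factS.
- have sumS : sumn (map S t') = sumn t' + size t'.
    by elim: (t') => //= y s ->; rewrite addnS addnA addSn.
  have := congr1 size def_l; have := congr1 sumn def_l.
  by rewrite sumS sumn_rcons size_rcons size_map; lia.
by rewrite sorted_map in sorted_l.
Qed.

End Hooks.

Section VandermondeProduct.
Local Open Scope ring_scope.

Lemma alternant_product N (a : 'X_{1..N}) :
  alternant a = \prod_(i < N) \prod_(j < N | (i < j)%N) ((a j)%:R - (a i)%:R).
Proof.
pose p k : {poly rat} := \prod_(c <- iota 0 k) ('X - (c%:R)%:P).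
have size_p k : size (p k) = k.+1 by rewrite size_prod_XsubC size_iota.
have horner_p k x : (p k).[x%:R] = (x ^_ k)%:R.
  elim: k => [|k IHk]; first by rewrite /p big_nil hornerC ffactn0.
  rewrite /p -addn1 iotaD big_cat big_seq1 hornerM -/(p k) IHk addn1 ffactnSr natrM !hornerE.
  by have [le_kx | lt_xk] := leqP k x; [rewrite natrB | rewrite ffact_small ?mul0r].
pose C : 'M[rat]_N := \matrix_(k, l) (p k)`_l.
pose x : 'rV[rat]_N := \row_i (a i)%:R.
have -> : alternant a = \det (C *m Vandermonde N x).
  rewrite /alternant -det_tr; congr (\det _); apply/matrixP => k i; rewrite !mxE.
  rewrite -horner_p (horner_coef_wide (n := N)) ?size_p //.
  by apply: eq_bigr => l _; rewrite !mxE.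
rewrite det_mulmx det_trig; last first.
  by apply/is_trig_mxP => k l lt_kl; rewrite mxE nth_default // size_p.
rewrite big1 ?mul1r => [|k _]; last first.
  have /monicP := monic_prod_XsubC (iota 0 k) predT (fun c => c%:R : rat).
  by rewrite /lead_coef -/(p k) size_p mxE.
rewrite det_Vandermonde; apply: eq_bigr => i _; apply: eq_bigr => j _.
by rewrite !mxE.
Qed.

Lemma vandermonde_product (x : nat -> nat) N :
    (forall i j, (i < j < N)%N -> (x i <= x j)%N) ->
  (vandermonde (rev (mkseq x N)))%:R =
  \prod_(i < N) \prod_(j < N | (i < j)%N) ((x j)%:R - (x i)%:R) :> rat.
Proof.
move=> x_incr; rewrite (exchange_big_dep predT) //=.
have -> : \prod_(j < N) \prod_(i < N | (i < j)%N) ((x j)%:R - (x i)%:R) =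
   \prod_(j < N) \prod_(i < j) ((x j)%:R - (x i)%:R) :> rat.
  apply: eq_bigr => j _.
  by rewrite (big_ord_widen N (fun i => (x j)%:R - (x i)%:R)) // ltnW.
elim: N x_incr => [_|N IHN x_incr]; first by rewrite big_ord0.
rewrite big_ord_recr /= -IHN => [|i j /andP[lt_ij lt_jN]]; last first.
  by apply: x_incr; rewrite lt_ij ltnW.
rewrite /mkseq -addn1 iotaD map_cat rev_cat /= natrM mulrC; congr (_ * _).
have -> : iota 0 N = index_iota 0 N by rewrite /index_iota subn0.
rewrite natr_prod bigop.big_rev big_map big_mkord; apply: eq_bigr => i _.
by rewrite natrB // x_incr // ltn_ord /=.
Qed.

End VandermondeProduct.

Section CodeShape.
Variable N : nat.
Implicit Types (w : 'S_N).

Lemma sumn_lam w : sumn (lam w) = inversions w.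
Proof.
rewrite /lam (perm_sumn (permEl (perm_sort _ _))) /inversions -big_enum /=.
rewrite -(big_map (@r_val N w) predT id) -sumnE.
by elim: map => //= -[|x] s /= ->.
Qed.

Lemma sorted_geq_split (l : seq nat) : sorted geq l ->
  l = filter (fun x => 0 < x) l ++ nseq (count_mem 0 l) 0.
Proof.
elim: l => //= x l IHl path_l; have := IHl (path_sorted path_l).
case: x path_l => [|x] path_l {1}-> //=.
have l0 : l = nseq (size l) 0.
  apply/all_pred1P; move: path_l; rewrite path_sortedE; last first.
    by move=> b a c /= le_ab /leq_trans; apply.
  by case/andP=> /allP le0 _; apply/allP => y /le0; rewrite /= leqn0.
by rewrite l0 filter_nseq count_nseq /= mul1n.
Qed.

Lemma weight_code w :
    (forall i j, adjacent i j -> r_val w i <= r_val w j) ->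
  (weight (staircase N + code w)%MM * (hooks (lam w))%:R = 1)%R.
Proof.
move=> r_incr; pose s := [seq r_val w i | i : 'I_N <- enum 'I_N].
have size_s : size s = N by rewrite size_map size_enum_ord.
have nth_s (i : 'I_N) : nth 0 s i = r_val w i.
  by rewrite (nth_map i) ?size_enum_ord // nth_ord_enum.
have sorted_s : sorted leq s.
  apply/(sortedP 0) => i; rewrite size_s => lt_i.
  rewrite (nth_s (Ordinal (ltnW lt_i))) (nth_s (Ordinal lt_i)).
  by apply: r_incr; rewrite /adjacent.
have sorted_rs : sorted geq (rev s) by rewrite rev_sorted.
pose x i := nth 0 s i + i.
have x_incr i j : i < j < N -> x i <= x j.
  move=> /andP[lt_ij lt_jN]; apply: leq_add; last exact: ltnW.
  apply: (sorted_leq_nth leq_trans leqnn 0 sorted_s); rewrite ?inE ?size_s //.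
    exact: ltn_trans lt_jN.
  exact: ltnW.
have def_x : shifted (rev s) = rev (mkseq x N).
  apply: (@eq_from_nth _ 0) => [|i].
    by rewrite size_shifted !size_rev size_mkseq.
  rewrite size_shifted size_rev size_s => lt_i.
  rewrite nth_shifted size_rev ?size_s // !nth_rev ?size_s ?size_mkseq //.
  by rewrite nth_mkseq // /x; lia.
have -> : hooks (lam w) = hooks (rev s).
  have -> : lam w = filter (fun x => 0 < x) (rev s).
    apply: (sorted_eq (leT := geq)).
    - by move=> b a c /= le_ab /leq_trans; apply.
    - by move=> a b /andP[] /=; lia.
    - by rewrite sort_sorted // => a b; apply: leq_total.
    - by apply: sorted_filter sorted_rs => b a c /= le_ab /leq_trans; apply.
    by rewrite /lam perm_sort filter_rev perm_sym perm_rev.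
  by rewrite [in RHS](sorted_geq_split sorted_rs) /hooks /hook cells_nseq0.
have AE i : (staircase N + code w)%MM i = x i.
  by rewrite mnmDE !mnmE /x nth_s addnC.
have := congr1 (fun k => k%:R%R : rat) (hook_product sorted_rs).
rewrite natrM def_x bigop.big_rev big_map vandermonde_product //.
have -> : iota 0 N = index_iota 0 N by rewrite /index_iota subn0.
rewrite big_mkord [in RHS]natr_prod /weight alternant_product => prodE.
have -> : (\prod_i ((staircase N + code w)%MM i)`!%:R = \prod_(i < N) (x i)`!%:R :> rat)%R.
  by apply: eq_bigr => i _; rewrite AE.
rewrite [X in (X / _)%R](_ : _ = \prod_(i < N) \prod_(j < N | (i < j)%N)
    ((x j)%:R - (x i)%:R))%R; last first.
  by apply: eq_bigr => i _; apply: eq_bigr => j _; rewrite !AE.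
rewrite mulrAC prodE divff //; apply/prodf_neq0 => i _.
by rewrite pnatr_eq0 -lt0n fact_gt0.
Qed.

End CodeShape.

Section CountChains.
Variables (d : Order.disp_t) (T : finPOrderType d) (bot top : T) (rk : T -> nat).
Hypothesis le_bot : forall y : T, (bot <= y)%O.
Hypothesis le_top : forall y : T, (y <= top)%O.
Hypothesis rk0 : forall y, rk y = 0 -> y = bot.
Hypothesis rk_bot : rk bot = 0.
Hypothesis rk_covers : forall x y : T, covers x y -> rk y = (rk x).+1.

Fixpoint chains_to k (y : T) : seq (seq T) :=
  if k is k'.+1 then
    [seq rcons c y | x <- [seq x <- enum T | covers x y], c <- chains_to k' x]
  else [:: [:: bot]].

Lemma chains_toP k y c : rk y = k ->
  reflect (exists p, [/\ c = bot :: p, path covers bot p & last bot p = y])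
          (c \in chains_to k y).
Proof.
elim: k y c => [|k IHk] y c rk_y.
  rewrite inE; apply: (iffP eqP) => [->|[p [-> path_p last_p]]].
    by exists [::]; rewrite (rk0 rk_y).
  case/lastP: p path_p last_p => // p z; rewrite rcons_path last_rcons => /andP[_ cov_z] eq_z.
  by have := rk_covers cov_z; rewrite eq_z rk_y.
apply: (iffP allpairsPdep) => [[x [c' [+ c'_x ->]]]|[p [-> path_p last_p]]].
  rewrite mem_filter => /andP[cov_xy _].
  have rk_x : rk x = k by apply: succn_inj; rewrite -(rk_covers cov_xy).
  have [p [-> path_p last_p]] := IHk _ _ rk_x c'_x.
  by exists (rcons p y); rewrite rcons_path path_p last_p last_rcons.
case/lastP: p path_p last_p => [_ /= bot_y|p z]; first by rewrite -bot_y rk_bot in rk_y.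
rewrite rcons_path last_rcons => /andP[path_p cov_z] eq_z; rewrite eq_z in cov_z *.
exists (last bot p), (bot :: p); rewrite mem_filter cov_z mem_enum; split => //.
apply/IHk; last by exists p.
by apply: succn_inj; rewrite -(rk_covers cov_z).
Qed.

Lemma chains_to_uniq k y : rk y = k -> uniq (chains_to k y).
Proof.
elim: k y => // k IHk y rk_y.
have rk_x x : x \in [seq x <- enum T | covers x y] -> rk x = k.
  rewrite mem_filter => /andP[cov_xy _].
  by apply: succn_inj; rewrite -(rk_covers cov_xy).
apply: allpairs_uniq_dep => [|x /rk_x/IHk //|]; first by rewrite filter_uniq ?enum_uniq.
move=> _ _ /allpairsPdep[x [c [s_x c_x ->]]] /allpairsPdep[x' [c' [s_x' c'_x' ->]]] /=.
move=> /rcons_inj[eq_c]; rewrite -eq_c in c'_x' *.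
have [p [def_c _ <-]] := chains_toP _ (rk_x _ s_x) c_x.
have [p' [def_c' _ <-]] := chains_toP _ (rk_x _ s_x') c'_x'.
by move: def_c'; rewrite def_c => -[->].
Qed.

Lemma card_max_chains : #|max_chains T| = size (chains_to (rk top) top).
Proof.
rewrite cardE -(size_map val); apply/perm_size/uniq_perm.
- by rewrite map_inj_uniq ?enum_uniq //; apply: val_inj.
- exact: chains_to_uniq.
move=> c; apply/mapP/(chains_toP _ erefl) => [[b + eq_c]|[p [-> path_p last_p]]].
  rewrite mem_enum inE /= -[bseqval b]eq_c {b eq_c}; case: c => // x p.
  case/and3P=> /forallP le_x /forallP le_p path_p; exists p.
  have eq_x : x = bot by apply: le_anti; rewrite le_x le_bot.
  rewrite -eq_x path_p; split=> //.
  by apply: le_anti; rewrite le_top le_p.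
have chain_p : is_max_chain (bot :: p).
  by apply/and3P; split=> //; apply/forallP => y; rewrite ?last_p.
exists (Bseq (size_max_chain chain_p)) => //.
by rewrite mem_enum inE.
Qed.

Lemma max_chains_recursion (F : T -> rat) :
    F bot = 1%R ->
    (forall y, y != bot -> F y = \sum_(x | covers x y) F x)%R ->
  (#|max_chains T|%:R)%R = F top.
Proof.
move=> F_bot F_rec; rewrite card_max_chains.
have [k rk_top] : exists k, rk top = k by exists (rk top).
rewrite rk_top; elim: k (top) rk_top => [|k IHk] y rk_y.
  by rewrite (rk0 rk_y) F_bot.
rewrite F_rec; last by apply: contra_eq_neq rk_y => ->; rewrite rk_bot.
rewrite size_allpairs_dep sumnE big_map big_filter natr_sum big_enum_cond.
apply: eq_big => [//|x /= cov_xy].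
rewrite IHk //.
by apply: succn_inj; rewrite -(rk_covers cov_xy).
Qed.

End CountChains.

Section Standardization.
Variables (n M : nat).
Implicit Types (s t : M.-tuple 'I_n) (i j k l : 'I_M).

Definition before s i j : bool :=
  (tnth s i < tnth s j) || (tnth s i == tnth s j) && (i < j).

Lemma before_irr s i : before s i i = false.
Proof. by rewrite /before !ltnn andbF. Qed.

Lemma before_trans s i j k : before s i j -> before s j k -> before s i k.
Proof. by rewrite /before -!val_eqE /=; lia. Qed.

Lemma before_total s i j : i != j -> before s i j || before s j i.
Proof. by rewrite /before -!val_eqE /=; lia. Qed.

Definition rank s i : nat := #|[set j | before s j i]|.

Lemma rank_lt s i : rank s i < M.
Proof.
rewrite -[X in _ < X](card_ord M); apply: proper_card; rewrite properE subset_predT.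
by apply/subsetPn; exists i; rewrite // inE before_irr.
Qed.

Lemma rank_before s i j : before s i j -> rank s i < rank s j.
Proof.
move=> s_ij; apply/proper_card/properP; split=> [|]; last first.
  by exists i; rewrite inE ?before_irr.
by apply/subsetP => k; rewrite !inE => /before_trans; apply.
Qed.

Lemma rank_inj s : injective (fun i => Ordinal (rank_lt s i)).
Proof.
move=> i j /(congr1 val) /= eq_r; apply/eqP/negPn/negP => /(before_total s).
by case/orP=> /rank_before; rewrite eq_r ltnn.
Qed.

Definition std s : 'S_M := perm (@rank_inj s).

Lemma stdE s i : std s i = rank s i :> nat.
Proof. by rewrite permE. Qed.

Lemma std_lt s i j : (std s i < std s j) = before s i j.
Proof.
rewrite !stdE; apply/idP/idP => [|/rank_before //].
have [-> | /(before_total s)/orP[] //] := eqVneq i j; first by rewrite ltnn.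
by move/rank_before => lt_ji /(ltn_trans lt_ji); rewrite ltnn.
Qed.

Lemma std_descent s i j : adjacent i j -> (std s j < std s i) = (tnth s j < tnth s i).
Proof. by move=> /eqP def_j; rewrite std_lt /before def_j; lia. Qed.

Definition swap s i j : M.-tuple 'I_n := [tuple tnth s (tperm i j k) | k < M].

Lemma swapK s i j : swap (swap s i j) i j = s.
Proof. by apply: eq_from_tnth => k; rewrite !tnth_mktuple tpermK. Qed.

Lemma count_swap s i j a : count_mem a (swap s i j) = count_mem a s.
Proof.
rewrite -!sum1_count !big_tuple [RHS](reindex_inj (@perm_inj _ (tperm i j))) /=.
by apply: eq_bigl => k; rewrite tnth_mktuple.
Qed.

Lemma tperm_lt i j k l : adjacent i j ->
    ~ (k = i /\ l = j) -> ~ (k = j /\ l = i) ->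
  (tperm i j k < tperm i j l) = (k < l).
Proof.
move=> /eqP def_j ij ji.
have valE x : tperm i j x = (if x == i :> nat then i.+1 else
    if x == i.+1 :> nat then (i : nat) else x) :> nat.
  case: tpermP => [->|->|/eqP xi /eqP xj]; rewrite ?eqxx //.
    by rewrite def_j eqxx gtn_eqF.
  by rewrite -def_j !val_eqE (negPf xi) (negPf xj).
have {}ij : ~ (k = i :> nat /\ l = i.+1 :> nat).
  by rewrite -def_j => -[/val_inj ki /val_inj lj]; apply: ij.
have {}ji : ~ (k = i.+1 :> nat /\ l = i :> nat).
  by rewrite -def_j => -[/val_inj ki /val_inj lj]; apply: ji.
by rewrite !valE; do !case: eqP; lia.
Qed.

Lemma std_swap s i j : adjacent i j -> tnth s i != tnth s j ->
  std (swap s i j) = (tperm i j * std s)%g.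
Proof.
move=> adj_ij neq_s; apply/permP => k; apply: val_inj; rewrite permM /= !stdE.
rewrite /rank -[RHS](card_preimset _ (@perm_inj _ (tperm i j))).
apply: eq_card => l; rewrite !inE /before !tnth_mktuple.
congr (_ || _); case: eqP => //= eq_s; apply/esym; apply: tperm_lt => //.
  by case=> el ek; move: eq_s neq_s; rewrite el ek tpermL tpermR => ->; rewrite eqxx.
by case=> el ek; move: eq_s neq_s; rewrite el ek tpermL tpermR => ->; rewrite eqxx.
Qed.

End Standardization.

Section BubbleLattice.
Variables (n : nat) (m : 'I_n -> nat).
Hypothesis m_gt0 : forall a, 0 < m a.
Let M := mtotal m.
Implicit Types (w : M.-tuple 'I_n) (s t x y z : BL m) (i j k l p q : 'I_M) (a b c : 'I_n).

Definition ordered w : Prop :=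
  forall p c, c < tnth w p -> exists2 q : 'I_M, q < p & tnth w q = c.

Lemma index_tnth w p : index (tnth w p) w <= p.
Proof.
rewrite leqNgt; apply/negP => /(before_find (tnth w p)) /=.
by rewrite -tnth_nth eqxx.
Qed.

Lemma mem_tnth_index w a : a \in w -> exists2 p : 'I_M, p = index a w :> nat & tnth w p = a.
Proof.
move=> w_a; have lt_p : index a w < M by rewrite -[X in _ < X](size_tuple w) index_mem.
by exists (Ordinal lt_p) => //; rewrite (tnth_nth a) nth_index.
Qed.

Lemma is_BLP w : (forall a, count_mem a w = m a) -> is_BL w <-> ordered w.
Proof.
move=> count_w; split=> [/andP[_ /forallP idx]|ord_w].
  have step a b : b = a.+1 :> nat -> index a w < index b w.
    by move=> def_b; have /forallP/(_ b)/implyP := idx a; apply; apply/eqP.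
  have idx_lt e : forall c b, b = c + e.+1 :> nat -> index c w < index b w.
    elim: e => [|e IHe] c b def_b; first by apply: step; rewrite def_b addn1.
    have lt_c1 : c.+1 < n by apply: leq_ltn_trans (ltn_ord b); rewrite def_b; lia.
    apply: ltn_trans (step c (Ordinal lt_c1) erefl) (IHe _ _ _).
    by rewrite def_b /= addSnnS.
  move=> p c lt_c.
  have lt_idx : index c w < p.
    apply: leq_trans (index_tnth w p); apply: (idx_lt (tnth w p - c).-1); lia.
  have [|q def_q <-] := @mem_tnth_index w c; last by exists q; rewrite // def_q.
  by rewrite -index_mem size_tuple (ltn_trans lt_idx).
apply/andP; split; first by apply/forallP => a; rewrite count_w.
apply/forallP => a; apply/forallP => b; apply/implyP => /eqP def_b.
have [|p def_p w_p] := @mem_tnth_index w b; first by rewrite -has_pred1 has_count count_w.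
have [|q lt_qp w_q] := ord_w p a; first by rewrite w_p def_b.
by rewrite -def_p; apply: leq_ltn_trans lt_qp; rewrite -w_q index_tnth.
Qed.

Lemma BL_count s a : count_mem a s = m a.
Proof. by have /andP[/forallP/(_ a)/eqP] := BLvalP s. Qed.

Lemma BL_ordered s : ordered s.
Proof. by apply/is_BLP; [exact: BL_count | exact: BLvalP]. Qed.

Lemma swap_is_BL s i j : adjacent i j ->
    (tnth s i < tnth s j -> exists2 q : 'I_M, q < i & tnth s q = tnth s i) ->
  is_BL (swap s i j).
Proof.
move=> adj_ij first_i; have def_j := eqP adj_ij.
apply/is_BLP => [a|p c]; first by rewrite count_swap BL_count.
rewrite tnth_mktuple => lt_c; have [q lt_q s_q] := BL_ordered lt_c.
have [/andP[/eqP q_i /eqP p_j]|] := boolP ((q == i) && (tperm i j p == j)).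
  have p_i : p = i by rewrite -(tpermK i j p) p_j tpermR.
  have [|r lt_ri s_r] := first_i.
    by rewrite -[X in tnth s X < _]q_i s_q -[X in _ < tnth s X]p_j.
  exists r; first by rewrite p_i.
  rewrite tnth_mktuple tpermD; first by rewrite s_r -q_i s_q.
    by rewrite -val_eqE /= gtn_eqF.
  by rewrite -val_eqE /= gtn_eqF // def_j ltnW.
move=> neq; exists (tperm i j q); last by rewrite tnth_mktuple tpermK.
rewrite -[p](tpermK i j) tperm_lt //.
  by case=> q_i p_j; rewrite q_i p_j !eqxx in neq.
by case=> q_j p_i; move: lt_q; rewrite q_j p_i def_j ltnNge leqnSn.
Qed.

Definition swap_BL s i j : BL m := insubd s (swap s i j).

Lemma swap_BLE s i j : is_BL (swap s i j) -> swap_BL s i j = swap s i j :> M.-tuple _.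
Proof. by move=> BL_swap; rewrite /swap_BL val_insubd BL_swap. Qed.

Lemma BL_stepP z s : reflect
  (exists i j, [/\ adjacent i j, tnth s j < tnth s i & z = swap_BL s i j])
  (BL_step z s).
Proof.
apply: (iffP existsP) => [[i /existsP[j /and3P[adj_ij lt_z /eqP def_s]]]|].
  exists i, j; split=> //; rewrite ?def_s ?tnth_mktuple ?tpermL ?tpermR //.
  have def_z : swap s i j = z by rewrite def_s swapK.
  by apply: val_inj; rewrite /= swap_BLE def_z ?BLvalP.
case=> i [j [adj_ij lt_s ->]]; exists i; apply/existsP; exists j.
have BL_swap : is_BL (swap s i j) by apply: swap_is_BL => //; rewrite ltnNge ltnW.
rewrite swap_BLE // !tnth_mktuple tpermL tpermR.
apply/and3P; split=> //; apply/eqP/esym; exact: swapK.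
Qed.

Lemma std_swap_BL s i j : adjacent i j -> tnth s j < tnth s i ->
  std (swap_BL s i j) = (tperm i j * std s)%g.
Proof.
move=> adj_ij lt_s; rewrite swap_BLE ?std_swap //.
  by rewrite -val_eqE gtn_eqF.
by apply: swap_is_BL => //; rewrite ltnNge ltnW.
Qed.

Definition height s : nat := inversions (std s).

Lemma BL_step_height z s : BL_step z s -> height s = (height z).+1.
Proof.
case/BL_stepP=> i [j [adj_ij lt_s ->]]; rewrite /height std_swap_BL //.
rewrite -(@inversions_ascent _ _ i j) ?mulgA ?tperm2 ?mul1g //.
by apply: ascent_tperm; rewrite ?std_descent.
Qed.

Lemma BL_le_height x y : BL_le x y -> x = y \/ height x < height y.
Proof.
case/connectP=> p; elim: p x => [|z p IHp] x /= => [_ ->|]; first by left.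
case/andP=> /BL_step_height def_z path_p /(IHp _ path_p)[<-|lt_z]; right.
  by rewrite def_z.
by apply: leq_trans lt_z; rewrite def_z.
Qed.

Lemma covers_BL_step x y : covers x y = BL_step x y.
Proof.
apply/idP/idP => [/andP[lt_xy /forallP nobetween]|step_xy].
  have /connectP[[|z p] /= path_p def_y] : BL_le x y := ltW lt_xy.
    by rewrite def_y ltxx in lt_xy.
  case/andP: path_p => step_xz path_p.
  have le_zy : (z <= y)%O by apply/connectP; exists p.
  have lt_xz : (x < z)%O.
    rewrite lt_neqAle; apply/andP; split; last exact: connect1.
    by apply: contraTneq step_xz => <-; apply/negP => /BL_step_height; lia.
  have := nobetween z; rewrite lt_xz /= lt_neqAle le_zy andbT negbK => /eqP <-.
  exact: step_xz.
have lt_height u v : (u < v)%O -> height u < height v.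
  rewrite lt_neqAle => /andP[neq_uv /BL_le_height[eq_uv|//]].
  by rewrite eq_uv eqxx in neq_uv.
apply/andP; split.
  rewrite lt_neqAle; apply/andP; split; last exact: connect1.
  by apply: contraTneq step_xy => <-; apply/negP => /BL_step_height; lia.
apply/forallP => z; apply/negP => /andP[/lt_height + /lt_height].
by rewrite (BL_step_height step_xy); lia.
Qed.

End BubbleLattice.

Section Extrema.
Variables (n : nat) (m : 'I_n -> nat).
Hypothesis m_gt0 : forall a, 0 < m a.
Let M := mtotal m.
Implicit Types (w : M.-tuple 'I_n) (s t x y z : BL m) (i j k l p q : 'I_M) (a b c : 'I_n).

Definition no_descent s : Prop := forall i j, adjacent i j -> tnth s i <= tnth s j.

(* Swapping an ascent ab leaves BL(m) exactly when this a is the first one. *)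
Definition no_free_ascent s : Prop :=
  forall i j, adjacent i j -> tnth s i < tnth s j ->
  forall q, q < i -> tnth s q != tnth s i.

Lemma BL_perm_eq x y : perm_eq x y.
Proof. by apply/allP => a _; rewrite /= !BL_count. Qed.

Lemma no_descent_uniq x y : no_descent x -> no_descent y -> x = y.
Proof.
have sorted_of z : no_descent z -> sorted (relpre (@nat_of_ord n) leq) z.
  move=> nodesc; case def_z: (val (val z)) => [//|a r]; rewrite -def_z.
  apply/(sortedP a) => i; rewrite size_tuple => lt_i.
  have := nodesc (Ordinal (ltnW lt_i)) (Ordinal lt_i) (eqxx _).
  by rewrite !(tnth_nth a).
move=> /sorted_of sorted_x /sorted_of sorted_y; apply/val_inj/val_inj.
apply: (sorted_eq _ _ sorted_x sorted_y (BL_perm_eq x y)) => [b a c|a b /anti_leq/val_inj //].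
exact: leq_trans.
Qed.

Lemma below_no_descent y : exists2 x, BL_le x y & no_descent x.
Proof.
have [k] := ubnP (height y); elim: k y => // k IHk y; rewrite ltnS => le_k.
have [/existsP[i /existsP[j /andP[adj_ij lt_y]]] | /existsPn nodesc] :=
  boolP [exists i : 'I_M, exists j : 'I_M, adjacent i j && (tnth y j < tnth y i)].
  have step_y : BL_step (swap_BL y i j) y by apply/BL_stepP => //; exists i, j.
  have [|x le_x nodesc_x] := IHk (swap_BL y i j).
    by apply: leq_trans le_k; rewrite (BL_step_height m_gt0 step_y).
  by exists x => //; apply: connect_trans le_x (connect1 step_y).
exists y; first exact: connect0.
move=> i j adj_ij; have /existsPn/(_ j) := nodesc i.
by rewrite adj_ij -leqNgt.
Qed.

Lemma above_no_free_ascent x : exists2 y, BL_le x y & no_free_ascent y.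
Proof.
have [k] := ubnP (M * M - height x); elim: k x => // k IHk x; rewrite ltnS => le_k.
have [/existsP[i /existsP[j /and3P[adj_ij lt_x]]] | /existsPn noasc] :=
  boolP [exists i : 'I_M, exists j : 'I_M, [&& adjacent i j, tnth x i < tnth x j &
          [exists q : 'I_M, (q < i) && (tnth x q == tnth x i)]]].
  case/existsP=> q /andP[lt_qi /eqP x_q].
  have BL_swap : is_BL (swap x i j) by apply: swap_is_BL => // _; exists q.
  have step_x : BL_step x (swap_BL x i j).
    apply/BL_stepP => //; exists i, j.
    rewrite swap_BLE // !tnth_mktuple tpermL tpermR; split=> //.
    by apply: val_inj; rewrite /= swap_BLE swap_BLE // swapK ?BLvalP.
  have [|y le_y noasc_y] := IHk (swap_BL x i j).
    have := inversions_le (std (swap_BL x i j)).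
    rewrite -/(height (swap_BL x i j)) (BL_step_height m_gt0 step_x).
    by move: le_k; rewrite -/M; lia.
  by exists y => //; apply: connect_trans (connect1 step_x) le_y.
exists x; first exact: connect0.
move=> i j adj_ij lt_x q lt_qi; apply/negP => x_q.
have /existsPn/(_ j)/negP := noasc i; case; rewrite adj_ij lt_x.
by apply/existsP; exists q; rewrite lt_qi.
Qed.

(* Were p not the letter at position p, the first p would be preceded by a     *)
(* repeated smaller letter.                                                    *)
Lemma no_free_ascent_prefix y p : no_free_ascent y -> p < n -> tnth y p = p :> nat.
Proof.
move=> noasc; have [k] := ubnP p; elim: k p => // k IHk p; rewrite ltnS => le_pk lt_pn.
have IH q : q < p -> tnth y q = q :> nat.
  by move=> lt_qp; apply: IHk; [exact: leq_trans le_pk | exact: ltn_trans lt_pn].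
have [lt_py | lt_yp | //] := ltngtP p (tnth y p).
  have [|q lt_qp /(congr1 val) /= y_q] := @BL_ordered _ _ m_gt0 y p (Ordinal lt_pn).
    exact: lt_py.
  by have := IH q lt_qp; rewrite y_q => eq_pq; rewrite eq_pq ltnn in lt_qp.
have [|r def_r y_r] := @mem_tnth_index _ _ y (Ordinal lt_pn).
  by rewrite -has_pred1 has_count BL_count.
have lt_pr : p < r.
  rewrite ltnNge leq_eqVlt; apply/negP => /orP[/eqP/val_inj eq_rp|lt_rp].
    by move: lt_yp; rewrite -{1}eq_rp y_r /= ltnn.
  by have := IH _ lt_rp; rewrite y_r /= => eq_pr; rewrite eq_pr ltnn in lt_rp.
have lt_r1 : r.-1 < M by apply: leq_ltn_trans (ltn_ord r); apply: leq_pred.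
pose q := Ordinal lt_r1.
have adj_qr : adjacent q r by rewrite /adjacent /= prednK // (leq_trans _ lt_pr).
have le_pq : p <= q by rewrite /= -ltnS prednK // (leq_trans _ lt_pr).
have lt_yq : tnth y q < p.
  rewrite ltnNge leq_eqVlt; apply/negP => /orP[/eqP eq_yq | lt_py].
    have := index_tnth y q; rewrite (_ : tnth y q = Ordinal lt_pn).
      by rewrite -def_r (eqP adj_qr) ltnn.
    exact: val_inj.
  have [o lt_oq y_o] := @BL_ordered _ _ m_gt0 y q (Ordinal lt_pn) lt_py.
  have := index_tnth y o; rewrite y_o -def_r (eqP adj_qr) => lt_qo.
  by have := ltn_trans lt_oq lt_qo; rewrite ltnn.
have lt_yqM : tnth y q < M by apply: ltn_trans (ltn_ord p).
have := noasc q r adj_qr _ (Ordinal lt_yqM).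
rewrite y_r => /(_ lt_yq (leq_trans lt_yq le_pq))/eqP[].
by apply: val_inj; rewrite /= IH.
Qed.

Lemma no_free_ascent_suffix y i j : no_free_ascent y -> adjacent i j -> n <= i ->
  tnth y j <= tnth y i.
Proof.
move=> noasc adj_ij le_ni; rewrite leqNgt; apply/negP => lt_y.
have lt_yi := leq_trans (ltn_ord (tnth y i)) le_ni.
have lt_yM : tnth y i < M by apply: ltn_trans (ltn_ord i).
have /eqP[] := noasc i j adj_ij lt_y (Ordinal lt_yM) lt_yi.
by apply: val_inj; rewrite /= no_free_ascent_prefix /= ?ltn_ord.
Qed.

Definition top_seq : seq 'I_n :=
  enum 'I_n ++ flatten [seq nseq (m a).-1 a | a <- rev (enum 'I_n)].

Lemma count_top_seq a : count_mem a top_seq = m a.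
Proof.
rewrite count_cat (count_uniq_mem _ (enum_uniq _)) mem_enum count_flatten.
rewrite -map_comp sumnE big_map bigop.big_rev big_enum (bigD1 a) //= big1 => [|b ba].
  by rewrite count_nseq /= eqxx mul1n addn0 add1n prednK.
by rewrite count_nseq /= (negPf ba).
Qed.

Lemma size_top_seq : size top_seq = M.
Proof.
rewrite -count_predT -sum1_count (partition_big id predT) //=; apply: eq_bigr => a _.
by rewrite sum1_count count_top_seq.
Qed.

Lemma size_top_seqE : size top_seq == M. Proof. by rewrite size_top_seq. Qed.

Lemma top_is_BL : is_BL (Tuple size_top_seqE).
Proof.
apply/andP; split; first by apply/forallP => a; rewrite count_top_seq.
apply/forallP => a; apply/forallP => b; apply/implyP => /eqP def_b /=.
by rewrite !index_cat !mem_enum !index_enum_ord def_b.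
Qed.

Definition top : BL m := MkBL top_is_BL.

Lemma no_free_ascent_top y : no_free_ascent y -> y = top.
Proof.
move=> noasc; apply/val_inj/val_inj => /=.
have le_nM : n <= M by rewrite -size_top_seq size_cat size_enum_ord leq_addr.
have take_y : take n y = enum 'I_n.
  apply: (@inj_map _ _ val val_inj).
  rewrite val_enum_ord; apply: (@eq_from_nth _ 0) => [|i].
    by rewrite size_map size_takel ?size_tuple // size_iota.
  rewrite size_map size_takel ?size_tuple // => lt_in.
  rewrite (nth_map (Ordinal lt_in)) ?size_takel ?size_tuple // nth_take //.
  rewrite nth_iota // add0n.
  rewrite -[RHS](@no_free_ascent_prefix y (Ordinal (leq_trans lt_in le_nM))) //.
  by rewrite (tnth_nth (Ordinal lt_in)).
rewrite -[LHS](cat_take_drop n) take_y; congr (_ ++ _).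
have perm_drop : perm_eq (drop n y) (flatten [seq nseq (m a).-1 a | a <- rev (enum 'I_n)]).
  by rewrite -(perm_cat2l (enum 'I_n)) -{1}take_y cat_take_drop (BL_perm_eq y top).
apply: (sorted_eq (leT := relpre (@nat_of_ord n) geq)) perm_drop.
- by move=> b a c /= le_ba /leq_trans; apply.
- by move=> a b /= /andP[le_ba le_ab]; apply/val_inj/eqP; rewrite eqn_leq le_ab.
- case def_y: (drop n y) => [//|a r]; rewrite -def_y.
  apply/(sortedP a) => i; rewrite size_drop size_tuple => lt_i.
  rewrite !nth_drop addnS /=.
  have lt_ni : (n + i).+1 < M by rewrite -/M in lt_i; lia.
  have := @no_free_ascent_suffix y (Ordinal (ltnW lt_ni)) (Ordinal lt_ni) noasc (eqxx _).
  by rewrite /= leq_addr !(tnth_nth a) /=; apply.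
rewrite sorted_pairwise; last by move=> b a c /= le_ba /leq_trans; apply.
have: pairwise (relpre (@nat_of_ord n) geq) (rev (enum 'I_n)).
  rewrite -sorted_pairwise; last by move=> b a c /= le_ba /leq_trans; apply.
  by rewrite rev_sorted -sorted_map val_enum_ord iota_sorted.
elim: (rev _) => //= a r IHr /andP[a_r /IHr pair_r].
rewrite pairwise_cat pair_r andbT; apply/andP; split.
  apply/allrelP => _ x /nseqP[-> _] /flatten_mapP[b r_b /nseqP[-> _]].
  exact: (allP a_r).
by elim: (_.-1) => //= k ->; rewrite andbT all_nseq /= leqnn orbT.
Qed.

End Extrema.

Section TopWord.
Variables (n : nat) (m : 'I_n -> nat).
Hypothesis m_gt0 : forall a, 0 < m a.
Let M := mtotal m.
Implicit Types (w : M.-tuple 'I_n) (u v r : seq 'I_n) (a b c : 'I_n).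

Lemma rank_count w (p : 'I_M) : (forall a, count_mem a w = m a) ->
  rank w p = psum m (tnth w p) + count_mem (tnth w p) (take p w).
Proof.
move=> count_w; set a := tnth w p.
rewrite /rank (_ : [set q | _] = [set q | tnth w q < a] :|:
    [set q : 'I_M | (tnth w q == a) && (q < p)]); last by apply/setP => q; rewrite !inE.
rewrite cardsU (_ : _ :&: _ = set0) ?cards0 ?subn0; last first.
  by apply/setP => q; rewrite !inE -val_eqE /=; lia.
congr (_ + _).
  rewrite -sum1dep_card (partition_big (tnth w) (fun b => b < a)) //=.
  apply: eq_bigr => b lt_ba; rewrite -count_w -sum1_count big_tuple.
  by apply: eq_bigl => q /=; case: (eqVneq (tnth w q) b) => [->|_]; rewrite ?lt_ba ?andbF.
rewrite -sum1dep_card -sum1_count (big_nth a) size_takel; last first.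
  by rewrite size_tuple ltnW.
rewrite big_mkord.
rewrite [RHS](big_ord_widen_cond M (fun i => nth a (take p w) i == a) (fun=> 1));
  last exact: ltnW.
apply: eq_bigl => q; rewrite andbC [RHS]andbC; case: ltnP => //= lt_qp.
by rewrite nth_take // -tnth_nth.
Qed.

Fixpoint labels u v : seq nat :=
  if v is a :: v' then (psum m a + count_mem a u).+1 :: labels (rcons u a) v' else [::].

Lemma size_labels u v : size (labels u v) = size v.
Proof. by elim: v u => //= a v IHv u; rewrite IHv. Qed.

Lemma nth_labels u v a p : p < size v ->
  nth 0 (labels u v) p =
    (psum m (nth a v p) + count_mem (nth a v p) (u ++ take p v)).+1.
Proof.
elim: v u p => // b v IHv u [|p] lt_p /=; first by rewrite cats0.
by rewrite IHv // cat_rcons.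
Qed.

Lemma labels_cat u v r : labels u (v ++ r) = labels u v ++ labels (u ++ v) r.
Proof.
elim: v u => [|a v IHv] u /=; first by rewrite cats0.
by rewrite IHv cat_rcons.
Qed.

Lemma labels_uniq u v : uniq (u ++ v) -> labels u v = [seq (psum m a).+1 | a <- v].
Proof.
elim: v u => //= a v IHv u; rewrite -cat_rcons => uniq_uv; rewrite IHv //.
suff /count_memPn-> : a \notin u by rewrite addn0.
by move: uniq_uv; rewrite cat_uniq rcons_uniq => /and3P[/andP[]].
Qed.

Lemma labels_nseq u a k :
  labels u (nseq k a) = iota (psum m a + count_mem a u).+1 k.
Proof.
elim: k u => //= k IHk u.
by rewrite IHk -cats1 count_cat /= eqxx !addn1 addnS.
Qed.

Lemma labels_blocks u v : uniq v -> {in v, forall a, count_mem a u = 1} ->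
  labels u (flatten [seq nseq (m a).-1 a | a <- v]) =
    flatten [seq iota (psum m a).+2 (m a).-1 | a <- v].
Proof.
elim: v u => //= a v IHv u /andP[v'a uniq_v] count_u.
rewrite labels_cat labels_nseq count_u ?inE ?eqxx // addn1 IHv // => b v_b.
rewrite count_cat count_u ?inE ?v_b ?orbT // count_nseq /=.
by case: eqP v'a => [->|]; rewrite ?v_b.
Qed.

Lemma labels_top_seq : labels [::] (top_seq m) = beta_word m.
Proof.
rewrite labels_cat labels_uniq ?enum_uniq // labels_blocks ?rev_uniq ?enum_uniq //.
by move=> a _; rewrite (count_uniq_mem _ (enum_uniq _)) mem_enum.
Qed.

Lemma one_line_inj N : injective (@one_line N).
Proof.
move=> s t eq_st; apply/permP => i; apply/val_inj/succn_inj.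
have: nth 0 (one_line s) i = nth 0 (one_line t) i by rewrite eq_st.
by rewrite (nth_map i) ?size_enum_ord // [in RHS](nth_map i) ?size_enum_ord // nth_ord_enum.
Qed.

Lemma one_line_std_top : one_line (std (top m_gt0)) = beta_word m.
Proof.
rewrite -labels_top_seq; apply: (@eq_from_nth _ 0) => [|i].
  by rewrite size_labels size_map size_enum_ord size_top_seq.
rewrite size_map size_enum_ord => lt_i; pose p := Ordinal lt_i.
rewrite (nth_map p) ?size_enum_ord // (nth_ord_enum p p) stdE rank_count; last first.
  exact: count_top_seq.
have a := tnth (top m_gt0) p.
by rewrite (@nth_labels _ _ a) ?size_top_seq // (tnth_nth a).
Qed.

Lemma BL_le_top y : BL_le y (top m_gt0).
Proof.
have [z le_yz noasc] := above_no_free_ascent m_gt0 y.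
by rewrite -(no_free_ascent_top m_gt0 noasc).
Qed.

Lemma top_no_free_ascent : no_free_ascent (top m_gt0).
Proof.
have [z _ noasc] := above_no_free_ascent m_gt0 (top m_gt0).
by rewrite -(no_free_ascent_top m_gt0 noasc).
Qed.

Lemma no_free_ascent_r_val (y : BL m) i j : no_free_ascent y -> adjacent i j ->
  r_val (std y) i <= r_val (std y) j.
Proof.
move=> noasc adj_ij.
have [lt_ij | ge_ij] := boolP (std y j < std y i).
  exact/ltnW/r_val_descent_lt.
have lt_y : before y i j.
  case/orP: (before_total y (adjacent_neq adj_ij)) => //.
  by rewrite -std_lt (negPf ge_ij).
apply/subset_leq_card/subsetP => k; rewrite !inE !std_lt => /andP[lt_ki y_ik].
have lt_kj : k < j by rewrite (eqP adj_ij) ltnW.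
rewrite lt_kj /=; move: y_ik lt_y; rewrite /before.
rewrite (ltnNge i k) (ltnW lt_ki) andbF orbF => lt_yik.
have [lt_yij _|_ /= /andP[/eqP <- _]] := boolP (tnth y i < tnth y j); last by rewrite lt_yik.
have [q lt_qk y_q] := BL_ordered m_gt0 lt_yik.
by have := noasc i j adj_ij lt_yij q (ltn_trans lt_qk lt_ki); rewrite y_q eqxx.
Qed.

End TopWord.

Lemma functionalX N (a : 'X_{1..N}) : functional 'X_[a] = weight a.
Proof. by rewrite /functional msuppX big_seq1 mcoeffX eqxx mul1r. Qed.

Lemma functional_dominant N (w : 'S_N) f :
    (forall i j, adjacent i j -> r_val w i <= r_val w j) -> schubert w f ->
  (functional ('X_[staircase N] * f) = (hooks (lam w))%:R^-1)%R.
Proof.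
move=> r_incr /schubert_uniq/(_ (schubert_dominant r_incr)) ->.
rewrite -mpolyXD functionalX; have E := weight_code r_incr.
have h0 : ((hooks (lam w))%:R != 0 :> rat)%R.
  by apply: contra_eq_neq E => ->; rewrite mulr0 eq_sym oner_eq0.
by apply: (mulIf h0); rewrite E mulVf.
Qed.

Section Counting.
Variables (n : nat) (m : 'I_n -> nat).
Hypothesis m_gt0 : forall a, 0 < m a.
Let M := mtotal m.
Variable S : 'S_M -> {mpoly rat[M]}.
Hypothesis schubert_S : forall w, schubert w (S w).
Implicit Types (x y : BL m).

Definition chain_count y : rat :=
  ((height y)`!%:R * functional ('X_[staircase M] * S (std y)))%R.

Lemma no_descent_r_val x i : no_descent x -> r_val (std x) i = 0.
Proof.
move=> nodesc; have [k] := ubnP i; elim: k i => // k IHk [[|i] lt_i] /= le_k.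
  by apply/eqP; rewrite -leqn0; apply: r_val_le.
pose i' := Ordinal (ltnW lt_i : i < M).
have adj_i : adjacent i' (Ordinal lt_i) by rewrite /adjacent.
apply/eqP; rewrite -leqn0 -(IHk i') //; apply: r_val_ascent_le.
rewrite /ascent adj_i ltn_neqAle leqNgt std_descent // -leqNgt nodesc // andbT.
by rewrite val_eqE (inj_eq perm_inj) adjacent_neq.
Qed.

Lemma no_descent_height x : no_descent x -> height x = 0.
Proof. by move=> nodesc; apply: big1 => i _; apply: no_descent_r_val. Qed.

Lemma height0_no_descent x : height x = 0 -> no_descent x.
Proof.
move=> h0 i j adj_ij; rewrite leqNgt; apply/negP => lt_x.
have step_x : BL_step (swap_BL x i j) x by apply/BL_stepP => //; exists i, j.
by have := BL_step_height m_gt0 step_x; rewrite h0.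
Qed.

Lemma chain_count_bot x : no_descent x -> chain_count x = 1%R.
Proof.
move=> nodesc; have r0 i : r_val (std x) i = 0 by apply: no_descent_r_val.
have lam0 : lam (std x) = [::].
  rewrite /lam (eq_map r0); set s := map _ _.
  by rewrite (_ : [seq _ <- s | _] = [::]) // /s; elim: (enum 'I_M).
rewrite /chain_count (functional_dominant _ (schubert_S _)) => [|i j _]; last by rewrite !r0.
by rewrite lam0 /hooks big_nil no_descent_height // invr1 mulr1.
Qed.

Lemma chain_count_rec y : height y != 0 ->
  (chain_count y = \sum_(x | covers x y) chain_count x)%R.
Proof.
case def_h: (height y) => [//|h] _.
pose D := [set p : 'I_M * 'I_M | adjacent p.1 p.2 && (tnth y p.2 < tnth y p.1)].
pose f (p : 'I_M * 'I_M) := swap_BL y p.1 p.2.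
have f_inj : {in D &, injective f}.
  move=> [i j] [i' j']; rewrite !inE /f /= => /andP[adj_ij lt_ij] /andP[adj_ij' lt_ij'].
  move/(congr1 (@std _ _ \o val)); rewrite /= !std_swap_BL // => /mulIg eq_t.
  have := congr1 (fun t : 'S_M => t i) eq_t; rewrite tpermL.
  move: (eqP adj_ij) (eqP adj_ij'); case: tpermP => [-> _ _ -> //|->|_ _].
    by move=> def_j + eq_j; rewrite -eq_j def_j; lia.
  by move=> def_j _ eq_j; move: def_j; rewrite eq_j; lia.
have -> : (\sum_(x | covers x y) chain_count x = \sum_(x in f @: D) chain_count x)%R.
  apply: eq_bigl => x; rewrite covers_BL_step //.
  apply/BL_stepP/imsetP => // [[i [j [adj_ij lt_y ->]]]|[[i j]]].
    by exists (i, j); rewrite // inE adj_ij.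
  by rewrite inE => /andP[adj_ij lt_y] ->; exists i, j.
rewrite big_imset //= /chain_count def_h factS mulnC natrM -mulrA -def_h.
rewrite (@schubert_functional _ _ _ (fun i j => S (tperm i j * std y)%g)) //.
rewrite (exchange_big_dep predT) //= pair_big_dep mulr_sumr.
apply: eq_big => [[i j]|[i j] /= /andP[adj_ij lt_y]]; rewrite ?inE /=.
  by case: (boolP (adjacent i j)) => // adj_ij; rewrite std_descent.
rewrite std_descent // in lt_y; congr (_`!%:R * functional (_ * S _))%R.
  apply: succn_inj; rewrite -def_h; apply: BL_step_height => //.
  by apply/BL_stepP => //; exists i, j.
by rewrite std_swap_BL.
Qed.

Lemma card_BL_chains : (#|max_chains (BL m)|%:R = chain_count (top m_gt0))%R.
Proof.
have [bot _ nodesc] := below_no_descent m_gt0 (top m_gt0).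
have uniq_bot x : no_descent x -> x = bot by move/no_descent_uniq; apply.
apply: (@max_chains_recursion _ _ bot (top m_gt0) (@height n m) _ _ _ _ _ chain_count).
- move=> y; have [x le_xy /uniq_bot <-] := below_no_descent m_gt0 y.
  exact: le_xy.
- exact: BL_le_top.
- by move=> y /height0_no_descent/uniq_bot.
- exact: no_descent_height.
- by move=> x y; rewrite covers_BL_step // => /(BL_step_height m_gt0).
- exact: chain_count_bot.
move=> y neq_y; apply: chain_count_rec.
by apply: contra_neq neq_y => /height0_no_descent/uniq_bot.
Qed.

End Counting.

Theorem theorem5p1 (n : nat) (m : 'I_n -> nat) (hm : forall i : 'I_n, 0 < m i)
    (beta : 'S_(mtotal m)) (hbeta : one_line beta = beta_word m) :
  (#|max_chains (BL m)|%:R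
   = (sumn (lam beta))`!%:R
     / (\prod_(c <- cells (lam beta)) hook (lam beta) c)%N%:R :> rat)%R.
Proof.
have [S schubert_S] := fin_all_exists (@schubert_exists (mtotal m)).
have def_beta : beta = std (top hm).
  by apply: one_line_inj; rewrite hbeta one_line_std_top.
rewrite (card_BL_chains hm schubert_S) /chain_count /height -def_beta sumn_lam.
congr (_ * _)%R; apply: functional_dominant => // i j; rewrite def_beta.
exact/no_free_ascent_r_val/top_no_free_ascent.
Qed.
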